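(* Let $\mathbf d=(d_1,\dots,d_k)$ with $1\le d_1<\dots<d_k\le n$. The variety $SpR_{\mathbf d}$ is a tower of successive $\mathbb P^1$-fibrations.
   Context: The base field is $\mathbb C$. $W$ is a $2n$-dimensional vector space with basis $w_1,\dots,w_{2n}$ and symplectic form with $\langle w_i,w_{2n+1-i}\rangle=1$ for $1\le i\le n$, $\langle w_i,w_j\rangle=0$ for $j\ne2n+1-i$. $pr_k(\sum_ic_iw_i)=\sum_{i\ne k}c_iw_i$, and $W_{i,j}=\mathrm{span}(w_1,\dots,w_i,w_{j+1},\dots,w_{2n})$. The positive roots of $\mathfrak{sp}_{2n}$ are indexed by pairs $(i,j)$ with $1\le i\le j$, $i+j\le2n$. $P_{\mathbf d}$ is the set of those pairs corresponding to roots in the radical of the parabolic subalgebra defined by $\alpha_{d_1},\dots,\alpha_{d_k}$; explicitly, $(i,j)\in P_{\mathbf d}$ iff $1\le i\le j$, $i+j\le2n$ and $i\le d_l\le j$ for some $l$. The variety $SpR_{\mathbf d}\subset\prod_{(i,j)\in P_{\mathbf d}}Gr_i(W_{i,j})$ consists of collections of subspaces $V_{i,j}\subset W$, $(i,j)\in P_{\mathbf d}$, such that $\dim V_{i,j}=i$, $V_{i,j}\subset W_{i,j}$; $V_{i,j}\subset V_{i+1,j}$ and $pr_{j+1}V_{i,j}\subset V_{i,j+1}$ (whenever both indices are in $P_{\mathbf d}$); and the spaces $V_{i,2n-i}$ with $(i,2n-i)\in P_{\mathbf d}$ are isotropic. A tower of successive $\mathbb P^1$-fibrations is a variety $X$ admitting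 a sequence $X=X_N\to X_{N-1}\to\dots\to X_0=pt$ in which each map is a fibration with fiber $\mathbb P^1$. *)

(* Defs.v *)
From HB Require Import structures.
From mathcomp Require Import all_boot all_order all_algebra.
From mathcomp Require Import all_classical all_reals complex.

Set Implicit Arguments.
Unset Strict Implicit.
Unset Printing Implicit Defensive.

Import Order.TTheory GRing.Theory Num.Theory.

Local Open Scope classical_set_scope.
Local Open Scope ring_scope.

(* Varieties are taken in the classical sense: a set of closed points with a   *)
(* Zariski topology and a sheaf of functions with values in the base field k   *)
(* ("spaces with functions").  [regular U f] says that U is open and that the  *)
(* restriction of f to U is a section over U; by [regular_local] the values of *)
(* f outside U play no role.                                                   *)
Record fun_structure (k : fieldType) (T : Type) := Structure {
  zopen : set (set T);
  regular : set T -> set (T -> k);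
  zopenT : zopen setT;
  zopenI : forall U V, zopen U -> zopen V -> zopen (U `&` V);
  zopen_bigcup : forall F : set (set T),
    (forall U, F U -> zopen U) -> zopen (\bigcup_(U in F) U);
  regular_zopen : forall U f, regular U f -> zopen U;
  regular_cst : forall U c, zopen U -> regular U (fun=> c);
  regularD : forall U f g, regular U f -> regular U g ->
    regular U (fun x => f x + g x);
  regularM : forall U f g, regular U f -> regular U g ->
    regular U (fun x => f x * g x);
  zopen_neq0 : forall U f, regular U f -> zopen (U `&` [set x | f x != 0]);
  regularV : forall U f, regular U f ->
    regular (U `&` [set x | f x != 0]) (fun x => (f x)^-1);
  regular_local : forall U f, zopen U ->
    (forall x, U x -> exists V g,
      [/\ V x, regular V g & forall y, (U `&` V) y -> f y = g y]) ->
    regular U f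
}.

Record fun_space (k : fieldType) := Space {
  points :> Type;
  str : fun_structure k points
}.

Section Morphisms.
Context {k : fieldType}.
Implicit Types X Y : fun_space k.

Definition morphism X Y (f : X -> Y) : Prop :=
  (forall U, zopen (str Y) U -> zopen (str X) (f @^-1` U)) /\
  (forall U g, regular (str Y) U g -> regular (str X) (f @^-1` U) (g \o f)).

Definition isomorphism X Y (f : X -> Y) : Prop :=
  morphism f /\
  exists g : Y -> X, [/\ morphism g, cancel f g & cancel g f].

Definition isomorphic X Y : Prop := exists f : X -> Y, isomorphism f.

End Morphisms.

(* The smallest structure for which f is regular on U for all (U, f) in G.    *)
Section Generated.
Context {k : fieldType} {T : Type}.
Variable G : set (set T * (T -> k)).

Definition contains_gen (S : fun_structure k T) : Prop :=
  forall Uf, G Uf -> regular S Uf.1 Uf.2.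

Program Definition generated : fun_structure k T := {|
  zopen := [set U | forall S, contains_gen S -> zopen S U];
  regular := fun U => [set f | forall S, contains_gen S -> regular S U f]
|}.
Next Obligation. by move=> S _; apply: zopenT. Qed.
Next Obligation. move=> U V hU hV S hS; apply: zopenI; [exact: hU|exact: hV]. Qed.
Next Obligation. by move=> F hF S hS; apply: zopen_bigcup => U /hF; apply. Qed.
Next Obligation. by move=> U f hf S hS; apply: regular_zopen (hf S hS). Qed.
Next Obligation. by move=> U c hU S hS; apply: regular_cst; apply: hU. Qed.
Next Obligation.
by move=> U f g hf hg S hS; apply: regularD; [apply: hf|apply: hg].
Qed.
Next Obligation.
by move=> U f g hf hg S hS; apply: regularM; [apply: hf|apply: hg].
Qed.
Next Obligation. by move=> U f hf S hS; apply: zopen_neq0; apply: hf. Qed.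
Next Obligation. by move=> U f hf S hS; apply: regularV; apply: hf. Qed.
Next Obligation.
move=> U f hU hloc S hS; apply: regular_local; first exact: hU.
move=> x /hloc [V [g [Vx hg e]]]; exists V, g; split=> //; exact: hg.
Qed.

End Generated.

Section Constructions.
Context {k : fieldType}.
Implicit Types X Y : fun_space k.

Definition pullback (T : Type) X (p : T -> X) : set (set T * (T -> k)) :=
  [set Uf | exists U f,
    regular (str X) U f /\ Uf = (p @^-1` U, f \o p)].

Definition sub_space X (A : set X) : fun_space k :=
  Space (generated (pullback (fun x : {x : X | A x} => sval x))).

Definition prod_space X Y : fun_space k :=
  Space (generated (pullback (@fst X Y) `|` pullback (@snd X Y))).

Definition bigprod_space (I : Type) (X : I -> fun_space k) : fun_space k :=
  Space (generated
    (\bigcup_i pullback (fun x : (forall i, X i) => x i))).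

Definition point_space : fun_space k := @Space k unit (generated set0).

End Constructions.

Section Universal.
Context {k : fieldType}.
Implicit Types X Y Z : fun_space k.

Program Definition pushforward Z (T : Type) (c : Z -> T) : fun_structure k T := {|
  zopen := [set U | zopen (str Z) (c @^-1` U)];
  regular := fun U => [set f : T -> k |
    zopen (str Z) (c @^-1` U) /\ regular (str Z) (c @^-1` U) (f \o c)]
|}.
Next Obligation. by move=> *; apply: zopenT. Qed.
Next Obligation. by move=> Z T c U V; apply: zopenI. Qed.
Next Obligation.
move=> Z T c F hF; rewrite /mkset preimage_bigcup.
have -> : \bigcup_(i in F) (c @^-1` i) =
          \bigcup_(U in [set c @^-1` V | V in F]) U.
  by rewrite bigcup_image.
by apply: zopen_bigcup => _ [V FV <-]; apply: hF.
Qed.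
Next Obligation. by move=> Z T c U f []. Qed.
Next Obligation. by move=> Z T c U a hU; split=> //; apply: regular_cst. Qed.
Next Obligation. by move=> Z T c U f g [? ?] [? ?]; split=> //; apply: regularD. Qed.
Next Obligation. by move=> Z T c U f g [? ?] [? ?]; split=> //; apply: regularM. Qed.
Next Obligation. by move=> Z T c U f [_ /zopen_neq0]. Qed.
Next Obligation.
by move=> Z T c U f [_ h]; split; [exact: zopen_neq0 h|exact: regularV h].
Qed.
Next Obligation.
move=> Z T c U f hU hloc; split=> //; apply: regular_local => // z Uz.
have [V [g [Vz [_ hg] e]]] := hloc _ Uz.
by exists (c @^-1` V), (g \o c); split=> // y; apply: e.
Qed.

(* This is what makes [sub_space], [prod_space] and [bigprod_space] satisfy   *)
(* the universal properties of subspaces and products.                        *)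
Lemma morphism_generated Z (T : Type) (G : set (set T * (T -> k)))
    (c : Z -> Space (generated G)) :
  (forall U f, G (U, f) -> regular (str Z) (c @^-1` U) (f \o c)) ->
  morphism c.
Proof.
move=> hc.
have hG : contains_gen G (pushforward c).
  by move=> [U f] /hc h; split=> //; apply: regular_zopen h.
by split=> [U /(_ _ hG)//|U g /(_ _ hG) []].
Qed.

End Universal.

Section Grassmannian.
Context {k : fieldType} {N : nat}.

Definition grass_carrier (m : nat) (U : {vspace 'rV[k]_N}) : Type :=
  {V : {vspace 'rV[k]_N} | (V <= U)%VS /\ \dim V = m}.

(* The I-th Pluecker coordinate of V in its basis [vbasis V]; only ratios of  *)
(* these are independent of the basis.                                        *)
Definition plucker (m : nat) (I : {ffun 'I_m -> 'I_N})
    (V : {vspace 'rV[k]_N}) : k :=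
  \det (\matrix_(a < m, b < m) (vbasis V)`_a 0 (I b)).

(* Gr_m(U), with the structure given by its Pluecker embedding: p_J / p_I is   *)
(* regular where p_I does not vanish.                                         *)
Definition Gr (m : nat) (U : {vspace 'rV[k]_N}) : fun_space k :=
  @Space k (grass_carrier m U) (generated
    [set Uf | exists I J : {ffun 'I_m -> 'I_N},
       Uf = ([set V : grass_carrier m U | plucker I (sval V) != 0],
             fun V => plucker J (sval V) / plucker I (sval V))]).

End Grassmannian.

(* For m = 1 the Pluecker coordinates are the homogeneous coordinates.        *)
Definition P1 (k : fieldType) : fun_space k := Gr 1 (fullv : {vspace 'rV[k]_2}).

(* Zariski-locally trivial fibrations with fiber P^1.                         *)
Definition P1_fibration (k : fieldType) (X Y : fun_space k) (f : X -> Y) : Prop :=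
  morphism f /\
  forall y : Y, exists U : set Y, [/\ zopen (str Y) U, U y &
    exists phi : sub_space (f @^-1` U) -> prod_space (sub_space U) (P1 k),
      isomorphism phi /\ forall x, sval (phi x).1 = f (sval x)].

(* No separate requirement that the intermediate spaces be varieties is       *)
(* needed: a space with a locally trivial P^1-fibration over a variety is one. *)
Inductive P1_tower (k : fieldType) : fun_space k -> Prop :=
| P1_tower_point (X : fun_space k) : isomorphic X point_space -> P1_tower X
| P1_tower_step (X Y : fun_space k) (f : X -> Y) :
    P1_fibration f -> P1_tower Y -> P1_tower X.

Section SpR.
Variables (k : fieldType) (n : nat) (d : seq nat).

Local Notation W := 'rV[k]_(2 * n).

(* Ordinals are 0-based: [w a] is the vector w_{a+1}.                         *)
Definition w (a : 'I_(2 * n)) : W := delta_mx 0 a.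

(* <w_i, w_{2n+1-i}> is 1 for i <= n and, by antisymmetry, -1 for i > n.      *)
Definition sympl (u v : W) : k :=
  \sum_(a < 2 * n) (-1) ^+ (n <= a)%N * (u 0 a * v 0 (rev_ord a)).

Definition isotropic (V : {vspace W}) : Prop :=
  forall u v, u \in V -> v \in V -> sympl u v = 0.

Definition pr (l : nat) (v : W) : W := \sum_(a < 2 * n | a.+1 != l) v 0 a *: w a.

Definition Wspan (i j : nat) : {vspace W} :=
  <<[seq w a | a in [pred a : 'I_(2 * n) | (a.+1 <= i)%N || (j.+1 <= a.+1)%N]]>>%VS.

(* The conditions 1 <= i <= j and i + j <= 2n force i, j < 2n.                *)
Definition inP (ij : 'I_(2 * n) * 'I_(2 * n)) : bool :=
  [&& (1 <= ij.1)%N, (ij.1 <= ij.2)%N, (ij.1 + ij.2 <= 2 * n)%N &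
      has (fun dl => (ij.1 <= dl <= ij.2)%N) d].

Definition Pd : Type := {ij : 'I_(2 * n) * 'I_(2 * n) | inP ij}.
Definition row_of (p : Pd) : nat := (sval p).1.
Definition col_of (p : Pd) : nat := (sval p).2.

Definition SpR_ambient : fun_space k :=
  bigprod_space (fun p : Pd => Gr (row_of p) (Wspan (row_of p) (col_of p))).

Definition SpR_set : set SpR_ambient := [set V |
  [/\ forall p q : Pd, row_of q = (row_of p).+1 -> col_of q = col_of p ->
        (sval (V p) <= sval (V q))%VS,
      forall p q : Pd, row_of q = row_of p -> col_of q = (col_of p).+1 ->
        forall v, v \in sval (V p) -> pr (col_of p).+1 v \in sval (V q)
    & forall p : Pd, (row_of p + col_of p)%N = (2 * n)%N ->
        isotropic (sval (V p))]].

Definition SpR : fun_space k := sub_space SpR_set.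

End SpR.

(* Main.v *)
Require Import Defs.
From HB Require Import structures.
From mathcomp Require Import all_boot all_order all_algebra.
From mathcomp Require Import all_classical all_reals complex.
From mathcomp Require Import zify.

Set Implicit Arguments.
Unset Strict Implicit.
Unset Printing Implicit Defensive.

Import Order.TTheory GRing.Theory Num.Theory.

(** The indices p = (i, j) are ordered so that (i - 1, j) and (i, j + 1) come
    before (i, j), and the variety is built by adding one subspace V_{i,j} at a
    time, for a set S of indices closed under predecessors. When all the earlier
    subspaces are given, the constraints on V_{i,j} say exactly that it lies
    between A = V_{i-1,j} (or 0 if i = 1), of dimension i - 1, and a subspace B
    of dimension i + 1:
    - if i + j < 2n, then B is the sum of V_{i,j+1} and the line of w_{j+1};
    - if i + j = 2n, then B is the orthogonal of A within W_{i,j}, because a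
      subspace containing A as a hyperplane is isotropic as soon as it is
      orthogonal to A, the form being alternating. That A itself is isotropic
      follows from pr_{j+1} A being contained in the isotropic V_{i-1,j+1}.
    So V_{i,j} / A is an arbitrary line in the plane B / A (lemmas
    [high_allowed], [allowed_high] and [allowed_low]).

    What has to be shown is that this is a Zariski-locally trivial fibration.
    The Grassmannian is handled through its functor of points: a map into it is
    a morphism if and only if the family of subspaces it defines has, locally, a
    frame with regular entries ([framed_Gr] and [morphism_to_Gr]; the reduced
    frame on a Pluecker chart is given by Cramer's rule). A family B of rank
    m + 2 containing a family A of rank m has near every point a frame that
    extends one of A by two vectors; these two vectors identify the spaces
    between A and B with lines in k^2, and the coordinates of vectors in that
    frame are regular, again by Cramer's rule ([flag_bundle_fibration]). *)

(** * Spaces with functions and their morphisms *)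

Section Spaces.
Local Open Scope classical_set_scope.
Local Open Scope ring_scope.
Context {k : fieldType}.
Implicit Types X Y Z : fun_space k.

Lemma zopen_local X (U : set X) :
  (forall x, U x -> exists V, [/\ zopen (str X) V, V x & V `<=` U]) ->
  zopen (str X) U.
Proof.
move=> h.
have -> : U = \bigcup_(V in [set V | zopen (str X) V /\ V `<=` U]) V.
  apply/seteqP; split=> [x /h [V [oV Vx VU]]|x [V [_ VU] Vx]]; last exact: VU.
  by exists V.
by apply: zopen_bigcup => V [].
Qed.

Lemma regular_sub X (U V : set X) f :
  regular (str X) U f -> zopen (str X) V -> V `<=` U -> regular (str X) V f.
Proof.
move=> rf oV VU; apply: regular_local => // x Vx; exists U, f.
by split=> //; apply: VU.
Qed.

Lemma regular_ext X (U : set X) f g :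
  regular (str X) U f -> (forall x, U x -> g x = f x) -> regular (str X) U g.
Proof.
move=> rf e; apply: regular_local; first exact: regular_zopen rf.
by move=> x Ux; exists U, f; split=> // y [Uy _]; apply: e.
Qed.

Lemma morphism_comp X Y Z (f : X -> Y) (g : Y -> Z) :
  morphism f -> morphism g -> morphism (g \o f).
Proof.
by move=> [f1 f2] [g1 g2]; split=> [U /g1 /f1 //|U h /g2 /f2].
Qed.

(** Every open set is the domain of a regular function, namely zero, so a map
    that pulls regular functions back to regular functions is continuous. *)
Lemma morphism_regular X Y (f : X -> Y) :
  (forall U g, regular (str Y) U g -> regular (str X) (f @^-1` U) (g \o f)) ->
  morphism f.
Proof.
move=> h; split=> // U oU.
exact: regular_zopen (h _ _ (regular_cst 0 oU)).
Qed.

Lemma morphism_pullback (T : Type) X (G : set (set T * (T -> k))) (p : T -> X) :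
  Defs.pullback p `<=` G -> @morphism k (Defs.Space (Defs.generated G)) X p.
Proof.
move=> pG; apply: morphism_regular => U g rg S hS.
by apply: (hS (p @^-1` U, g \o p)); apply: pG; exists U, g.
Qed.

Lemma morphism_sval X (A : set X) :
  morphism (fun x : sub_space A => sval x).
Proof. exact: morphism_pullback. Qed.

Lemma morphism_to_sub X Z (A : set X) (c : Z -> sub_space A) :
  morphism (fun z => sval (c z)) -> morphism c.
Proof.
move=> [_ h]; apply: morphism_generated => _ _ [U [f [rf [-> ->]]]]; exact: h.
Qed.

Lemma morphism_fst X Y : morphism (fst : prod_space X Y -> X).
Proof. by apply: morphism_pullback => x; left. Qed.

Lemma morphism_snd X Y : morphism (snd : prod_space X Y -> Y).
Proof. by apply: morphism_pullback => x; right. Qed.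

Lemma morphism_to_prod X Y Z (c : Z -> prod_space X Y) :
  morphism (fun z => (c z).1) -> morphism (fun z => (c z).2) -> morphism c.
Proof.
move=> [_ h1] [_ h2]; apply: morphism_generated => _ _ [] [U [f [rf [-> ->]]]].
  exact: h1.
exact: h2.
Qed.

Lemma morphism_proj (I : Type) (X : I -> fun_space k) i :
  morphism (fun x : bigprod_space X => x i).
Proof. by apply: morphism_pullback => x; exists i. Qed.

Lemma morphism_to_bigprod (I : Type) (X : I -> fun_space k) Z
    (c : Z -> bigprod_space X) :
  (forall i, morphism (fun z => c z i)) -> morphism c.
Proof.
move=> h; apply: morphism_generated => _ _ [i _ [U [f [rf [-> ->]]]]].
by case: (h i) => _; apply.
Qed.

Lemma morphism_cst X Y (y : Y) : morphism (fun _ : X => y).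
Proof.
apply: morphism_regular => U g _; apply: regular_cst.
apply: zopen_local => x Ux; exists setT; split=> //; exact: zopenT.
Qed.

End Spaces.

(** * Regular matrices and frames of subspaces *)

Section RegularMatrices.
Local Open Scope classical_set_scope.
Local Open Scope ring_scope.
Context {k : fieldType}.
Implicit Types X Y Z : fun_space k.

Lemma regular_sum X (U : set X) (I : Type) (r : seq I) (f : I -> X -> k) :
  zopen (str X) U -> (forall i, regular (str X) U (f i)) ->
  regular (str X) U (fun x => \sum_(i <- r) f i x).
Proof.
move=> oU rf; elim: r => [|i r IH].
  by apply: regular_ext (regular_cst 0 oU) _ => x _; rewrite big_nil.
by apply: regular_ext (regularD (rf i) IH) _ => x _; rewrite big_cons.
Qed.

Lemma regular_prod X (U : set X) (I : Type) (r : seq I) (f : I -> X -> k) :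
  zopen (str X) U -> (forall i, regular (str X) U (f i)) ->
  regular (str X) U (fun x => \prod_(i <- r) f i x).
Proof.
move=> oU rf; elim: r => [|i r IH].
  by apply: regular_ext (regular_cst 1 oU) _ => x _; rewrite big_nil.
by apply: regular_ext (regularM (rf i) IH) _ => x _; rewrite big_cons.
Qed.

Lemma regular_inv X (U : set X) f :
  regular (str X) U f -> (forall x, U x -> f x != 0) ->
  regular (str X) U (fun x => (f x)^-1).
Proof.
move=> rf f0; apply: regular_sub (regularV rf) (regular_zopen rf) _ => x Ux.
by split=> //; apply: f0.
Qed.

(** The openness clause is not implied by the other one when the matrices have
    no entries, and empty frames do occur (the zero subspace). *)
Definition mx_regular X (U : set X) m n (F : X -> 'M[k]_(m, n)) : Prop :=
  zopen (str X) U /\ forall i j, regular (str X) U (fun x => F x i j).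

Lemma mx_regular_cst X m n (M : 'M[k]_(m, n)) :
  mx_regular [set: X] (fun=> M).
Proof.
by split=> [|i j]; [exact: zopenT|exact: regular_cst (M i j) (zopenT _)].
Qed.

Lemma mx_regular_sub X (U V : set X) m n (F : X -> 'M[k]_(m, n)) :
  mx_regular U F -> zopen (str X) V -> V `<=` U -> mx_regular V F.
Proof.
move=> [oU rF] oV VU.
by split=> // i j; apply: regular_sub VU. Qed.

Lemma mx_regular_comp X Z (c : Z -> X) (U : set X) m n (F : X -> 'M[k]_(m, n)) :
  morphism c -> mx_regular U F -> mx_regular (c @^-1` U) (F \o c).
Proof.
move=> [c1 c2] [oU rF]; split=> [|i j]; first exact: c1.
exact: c2 (rF i j).
Qed.

Lemma mx_regular_sel X (U : set X) m n p q (F : X -> 'M[k]_(m, n))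
    (G : X -> 'M[k]_(p, q)) (f : 'I_p -> 'I_q -> 'I_m) (g : 'I_p -> 'I_q -> 'I_n) :
  mx_regular U F -> (forall x i j, G x i j = F x (f i j) (g i j)) ->
  mx_regular U G.
Proof.
move=> [oU rF] e; split=> // i j.
by apply: regular_ext (rF (f i j) (g i j)) _ => x _; apply: e.
Qed.

Lemma mx_regular_mul X (U : set X) m n p (F : X -> 'M[k]_(m, n))
    (G : X -> 'M[k]_(n, p)) :
  mx_regular U F -> mx_regular U G -> mx_regular U (fun x => F x *m G x).
Proof.
move=> [oU rF] [_ rG]; split=> // i j.
have h l := regularM (rF i l) (rG l j).
by apply: regular_ext (regular_sum _ oU h) _ => x _; by rewrite mxE.
Qed.

Lemma mx_regular_mull X (U : set X) m n p (C : 'M[k]_(m, n))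
    (G : X -> 'M[k]_(n, p)) :
  mx_regular U G -> mx_regular U (fun x => C *m G x).
Proof.
move=> rG; apply: mx_regular_mul => //.
apply: mx_regular_sub (mx_regular_cst _ _) rG.1 _ => //.
Qed.

Lemma mx_regular_mulr X (U : set X) m n p (C : 'M[k]_(n, p))
    (G : X -> 'M[k]_(m, n)) :
  mx_regular U G -> mx_regular U (fun x => G x *m C).
Proof.
move=> rG; apply: mx_regular_mul => //.
apply: mx_regular_sub (mx_regular_cst _ _) rG.1 _ => //.
Qed.

Lemma mx_regular_col X (U : set X) m n p (F : X -> 'M[k]_(m, p))
    (G : X -> 'M[k]_(n, p)) :
  mx_regular U F -> mx_regular U G -> mx_regular U (fun x => col_mx (F x) (G x)).
Proof.
move=> [oU rF] [_ rG]; split=> // i j; case: (split_ordP i) => l ->.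
  by apply: regular_ext (rF l j) _ => x _; rewrite col_mxEu.
by apply: regular_ext (rG l j) _ => x _; rewrite col_mxEd.
Qed.

Lemma regular_det X (U : set X) m (F : X -> 'M[k]_m) :
  mx_regular U F -> regular (str X) U (fun x => \det (F x)).
Proof.
move=> [oU rF]; apply: regular_sum => // s.
by apply: regularM (regular_cst _ oU) _; apply: regular_prod.
Qed.

Lemma mx_regular_inv X (U : set X) m (F : X -> 'M[k]_m) :
  mx_regular U F -> (forall x, U x -> F x \in unitmx) ->
  mx_regular U (fun x => invmx (F x)).
Proof.
move=> rF uF; have oU := rF.1; split=> // i j.
have rV : regular (str X) U (fun x => (\det (F x))^-1).
  apply: regular_inv; first exact: regular_det.
  by move=> x /uF; rewrite unitmxE unitfE.
have rA : regular (str X) U (fun x => cofactor (F x) j i).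
  apply: (regularM (regular_cst _ oU)).
  apply: regular_det; apply: (mx_regular_sel (f := fun a _ => lift j a)
    (g := fun _ => lift i) rF).
  by move=> x a b; rewrite !mxE.
by apply: regular_ext (regularM rV rA) _ => x Ux; rewrite /invmx uF // !mxE.
Qed.

Lemma zopen_unit X (U : set X) m (F : X -> 'M[k]_m) :
  mx_regular U F -> zopen (str X) (U `&` [set x | F x \in unitmx]).
Proof.
move=> /regular_det /zopen_neq0; congr (zopen _ (_ `&` _)).
by apply/funext => x; apply/propext; rewrite /mkset unitmxE unitfE.
Qed.

End RegularMatrices.

Section Frames.
Local Open Scope ring_scope.
Context {k : fieldType}.

Lemma row_free_minor m N (F : 'M[k]_(m, N)) :
  row_free F -> exists I : {ffun 'I_m -> 'I_N}, colsub I F \in unitmx.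
Proof.
move=> fF; have rF : row_full F^T by rewrite /row_full mxrank_tr.
exists (fullrankfun rF); rewrite -unitmx_tr trmx_mxsub.
exact: fullrowsub_unit.
Qed.

Lemma row_free_left m n p (F : 'M[k]_(m, n)) (C : 'M[k]_(n, p)) :
  row_free (F *m C) -> row_free F.
Proof.
by rewrite /row_free => /eqP h; rewrite eqn_leq rank_leq_row -{1}h mxrankM_maxl.
Qed.

Lemma minor_row_free m N (F : 'M[k]_(m, N)) (I : 'I_m -> 'I_N) :
  colsub I F \in unitmx -> row_free F.
Proof.
rewrite -row_free_unit => h.
by apply: (@row_free_left _ _ _ _ (colsub I 1%:M)); rewrite mulmx_colsub mulmx1.
Qed.

Lemma row_free_complete m p N (F : 'M[k]_(m, N)) :
  row_free F -> (m + p)%N = N -> exists C : 'M[k]_(p, N), row_free (col_mx F C).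
Proof.
move=> /eqP rF e.
have : \rank (F^C)%MS = p by rewrite mxrank_compl rF -e addKn.
move=> rp; case: p / rp e => e.
exists (row_base (F^C)%MS).
rewrite /row_free -addsmxE (adds_eqmx (eqmx_refl F) (eq_row_base _)).
by rewrite (eqP (addsmx_compl_full F)) e.
Qed.

Definition is_frame N m (V : {vspace 'rV[k]_N}) (F : 'M[k]_(m, N)) : Prop :=
  row_free F /\ forall v, (v \in V) = (v <= F)%MS.

(** The matrix whose maximal minors are the Pluecker coordinates of V. *)
Definition basis_mx N m (V : {vspace 'rV[k]_N}) : 'M[k]_(m, N) :=
  \matrix_(a < m, b < N) (vbasis V)`_a 0 b.

Lemma basis_mx_frame N m (V : {vspace 'rV[k]_N}) :
  \dim V = m -> is_frame V (basis_mx m V).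
Proof.
move=> e; case: m / e.
have mulE (u : 'rV_(\dim V)) :
    u *m basis_mx (\dim V) V = \sum_(i < \dim V) u 0 i *: (vbasis V)`_i.
  by apply/rowP => b; rewrite !mxE summxE; apply: eq_bigr => i _; rewrite !mxE.
split=> [|v].
  apply: inj_row_free => u; rewrite mulE => u0; apply/rowP => i; rewrite mxE.
  have /freeP := basis_free (vbasisP V).
  by move=> /(_ (fun i => u 0 i) u0).
apply/idP/submxP => [/coord_vbasis ->|[u ->]].
  exists (\row_i coord (vbasis V) i v); rewrite mulE.
  by apply: eq_bigr => i _; by rewrite mxE.
rewrite mulE; apply: rpred_sum => i _; apply: rpredZ; apply: vbasis_mem.
by rewrite memt_nth.
Qed.

Lemma frame_dim N m (V : {vspace 'rV[k]_N}) (F : 'M[k]_(m, N)) :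
  is_frame V F -> \dim V = m.
Proof.
move=> [/eqP fF mF]; have [/eqP fM mM] := basis_mx_frame (erefl (\dim V)).
rewrite -fF -[LHS]fM; apply: eqmx_rank.
have h p q (A : 'M_(p, N)) (B : 'M_(q, N)) :
    (forall v, (v \in V) = (v <= A)%MS) -> (forall v, (v \in V) = (v <= B)%MS) ->
    (A <= B)%MS.
  by move=> hA hB; apply/row_subP => i; rewrite -hB hA row_sub.
by apply/andP; split; apply: h.
Qed.

Definition mx_vspace N m (F : 'M[k]_(m, N)) : {vspace 'rV[k]_N} :=
  limg (linfun (mulmxr F : 'rV_m -> 'rV_N)).

Lemma mem_mx_vspace N m (F : 'M[k]_(m, N)) v :
  (v \in mx_vspace F) = (v <= F)%MS.
Proof.
apply/memv_imgP/submxP => [[u _ ->]|[u ->]]; exists u; rewrite ?lfunE //.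
exact: memvf.
Qed.

End Frames.

(** * Families of subspaces and maps into Grassmannians *)

Section Families.
Local Open Scope classical_set_scope.
Local Open Scope ring_scope.
Context {k : fieldType}.
Implicit Types X Y Z : fun_space k.

Definition framed X N m (V : X -> {vspace 'rV[k]_N}) : Prop :=
  forall x, exists U (F : X -> 'M[k]_(m, N)),
    [/\ U x, mx_regular U F & forall y, U y -> is_frame (V y) (F y)].

Lemma framed_dim X N m (V : X -> {vspace 'rV[k]_N}) x :
  framed m V -> \dim (V x) = m.
Proof. by move=> /(_ x) [U [F [Ux _ h]]]; apply: frame_dim (h x Ux). Qed.

Lemma framed_ext X N m (V V' : X -> {vspace 'rV[k]_N}) :
  framed m V -> (forall x, V' x = V x) -> framed m V'.
Proof. by move=> h /funext ->. Qed.

Lemma framed_comp X Z N m (V : X -> {vspace 'rV[k]_N}) (c : Z -> X) :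
  morphism c -> framed m V -> framed m (V \o c).
Proof.
move=> mc fV z; have [U [F [Uz rF h]]] := fV (c z).
exists (c @^-1` U), (F \o c); split=> //; last by move=> y; apply: h.
exact: mx_regular_comp.
Qed.

Lemma framed_cst X N (V : {vspace 'rV[k]_N}) m :
  \dim V = m -> framed m (fun _ : X => V).
Proof.
move=> e x; exists setT, (fun=> basis_mx m V); split=> //.
  exact: mx_regular_cst.
by move=> y _; apply: basis_mx_frame.
Qed.

Lemma framed_add X N m p (A B : X -> {vspace 'rV[k]_N}) :
  framed m A -> framed p B -> (forall x, (A x :&: B x = 0)%VS) ->
  framed (m + p) (fun x => A x + B x)%VS.
Proof.
move=> fA fB AB x; have [U [F [Ux rF hF]]] := fA x.
have [V [G [Vx rG hG]]] := fB x.
have oUV : zopen (str X) (U `&` V) by apply: zopenI; [apply: rF.1|apply: rG.1].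
exists (U `&` V), (fun y => col_mx (F y) (G y)); split=> //.
  by apply: mx_regular_col; [apply: mx_regular_sub rF oUV _|
    apply: mx_regular_sub rG oUV _] => y [].
move=> y [/hF [fFy mF] /hG [fGy mG]]; split=> [|v].
  apply: inj_row_free => u; rewrite -[u]hsubmxK mul_row_col => /eqP.
  rewrite addr_eq0 => /eqP e.
  have : lsubmx u *m F y \in (A y :&: B y)%VS.
    by rewrite memv_cap mF submxMl e mG eqmx_opp submxMl.
  rewrite AB memv0 => /eqP e0; move: e; rewrite e0 => /esym/eqP.
  rewrite oppr_eq0 => /eqP e1.
  have -> : lsubmx u = 0 by apply: (row_free_inj fFy); rewrite e0 mul0mx.
  have -> : rsubmx u = 0 by apply: (row_free_inj fGy); rewrite e1 mul0mx.
  by rewrite row_mx0.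
rewrite -addsmxE; apply/memv_addP/sub_addsmxP => [[a aA [b bB ->]]|[[a b] ->]].
  move: aA bB; rewrite mF mG => /submxP [u ->] /submxP [u' ->].
  by exists (u, u').
exists (a *m F y); first by rewrite mF submxMl.
by exists (b *m G y); rewrite ?mG ?submxMl.
Qed.

(** A constant matrix C that completes F *m O to an invertible square matrix at
    the given point also does so nearby; the last rows of the inverse of the
    transpose then form a regular frame of the orthogonal. *)
Lemma framed_perp X N m p (O : 'M[k]_N) (A B : X -> {vspace 'rV[k]_N}) :
  O \in unitmx -> framed m A -> (m + p)%N = N ->
  (forall x v, v \in B x <-> forall a, a \in A x -> a *m O *m v^T = 0) ->
  framed p B.
Proof.
move=> uO fA e; case: N / e O A B uO fA => O A B uO fA AB x.
have [U [F [Ux rF hF]]] := fA x.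
have fO y : U y -> row_free (F y *m O).
  move=> /hF [fFy _]; apply: inj_row_free => u; rewrite mulmxA => h.
  apply: (row_free_inj fFy); rewrite mul0mx -(mulmxK uO (u *m F y)).
  by rewrite h mul0mx.
have [C fC] := row_free_complete (fO _ Ux) (erefl (m + p)%N).
pose P y := (col_mx (F y *m O) C)^T : 'M_(m + p).
have rP : mx_regular U P.
  apply: (mx_regular_sel (F := fun y => col_mx (F y *m O) C)
    (f := fun _ j => j) (g := fun i _ => i)).
    apply: mx_regular_col; first exact: mx_regular_mulr.
    exact: mx_regular_sub (mx_regular_cst _ _) rF.1 _.
  by move=> y i j; by rewrite mxE.
pose V := U `&` [set y | P y \in unitmx].
have oV : zopen (str X) V by apply: zopen_unit.
have rI : mx_regular V (fun y => dsubmx (invmx (P y))).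
  apply: (mx_regular_sel (F := fun y => invmx (P y))
    (f := fun i _ => rshift m i) (g := fun _ j => j)).
    by apply: mx_regular_inv; [apply: mx_regular_sub rP oV _|] => y [].
  by move=> y i j; by rewrite mxE.
exists V, (fun y => dsubmx (invmx (P y))); split=> //.
  by split=> //; rewrite /mkset /P unitmx_tr -row_free_unit.
move=> y [Uy uP]; have [fFy mF] := hF y Uy.
set D := dsubmx _.
have DP : D *m P y = row_mx 0 1%:M.
  rewrite /D mul_dsub_mx mulVmx // scalar_mx_block /block_mx col_mxKd //.
move: DP; rewrite {1}/P tr_col_mx mul_mx_row => /eq_row_mx [DF DC].
split=> [|v].
  by apply: (@row_free_left _ _ _ _ _ C^T); rewrite DC /row_free mxrank1.
have -> : (v \in B y) = (v *m (F y *m O)^T == 0).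
  apply/idP/eqP => [/AB h|h].
    apply: trmx_inj; rewrite trmx_mul trmxK trmx0.
    apply/row_matrixP => i; rewrite row_mul row0 row_mul.
    by apply: h; rewrite mF row_sub.
  apply/AB => a; rewrite mF => /submxP [u ->].
  have : (F y *m O) *m v^T = 0 by rewrite -[LHS]trmxK trmx_mul trmxK h trmx0.
  by rewrite -!mulmxA => ->; rewrite mulmx0.
apply/eqP/submxP => [h|[u ->]]; last by rewrite -mulmxA DF mulmx0.
exists (v *m C^T); rewrite -[LHS](mulmxK uP) {1}/P tr_col_mx mul_mx_row h.
by rewrite -[invmx (P y)]vsubmxK mul_row_col mul0mx add0r.
Qed.

(** Cramer's rule, in the form that expresses the reduced frame of a subspace
    through ratios of its Pluecker coordinates. *)
Lemma cramer_minor m N (M : 'M[k]_(m, N)) (I : 'I_m -> 'I_N) a b :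
  colsub I M \in unitmx ->
  (invmx (colsub I M) *m M) a b =
  \det (colsub (fun c => if c == a then b else I c) M) / \det (colsub I M).
Proof.
move=> uM; rewrite /invmx uM -scalemxAl mxE mulrC; congr (_ / _).
rewrite (expand_det_col _ a) mxE; apply: eq_bigr => c _.
rewrite !mxE eqxx mulrC; congr (_ * (_ * \det _)); apply/matrixP => i j.
by rewrite !mxE eq_sym (negPf (neq_lift _ _)).
Qed.

Lemma pluckerE N m (I : {ffun 'I_m -> 'I_N}) (V : {vspace 'rV[k]_N}) :
  plucker I V = \det (colsub I (basis_mx m V)).
Proof. by congr (\det _); apply/matrixP => a b; rewrite !mxE. Qed.

Lemma framed_Gr N m (U : {vspace 'rV[k]_N}) :
  framed m (fun V : Gr m U => sval V).
Proof.
move=> V; have [_ dV] := svalP V.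
have [fM _] := basis_mx_frame dV; have [I uI] := row_free_minor fM.
pose M (V : Gr m U) := basis_mx m (sval V).
pose O : set (Gr m U) := [set V | plucker I (sval V) != 0].
have ratio (J : {ffun 'I_m -> 'I_N}) : regular (str (Gr m U)) O
    (fun V => plucker J (sval V) / plucker I (sval V)).
  by move=> S hS; apply: (hS (_, _)); exists I, J.
exists O, (fun V => invmx (colsub I (M V)) *m M V); split.
- by rewrite /O /mkset pluckerE -unitfE -unitmxE.
- split=> [|a b]; first exact: regular_zopen (ratio I).
  apply: regular_ext (ratio [ffun c => if c == a then b else I c]) _ => V' h.
  rewrite cramer_minor; last by rewrite unitmxE unitfE -pluckerE.
  by rewrite !pluckerE; congr (\det _ / _); apply/matrixP=> i j; rewrite !mxE ffunE.
- move=> V' h; have uV : colsub I (M V') \in unitmx.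
    by rewrite unitmxE unitfE -pluckerE.
  have [_ dV'] := svalP V'; have [fM' mM'] := basis_mx_frame dV'.
  have E : (invmx (colsub I (M V')) *m M V' :=: M V')%MS.
    by apply: eqmxMfull; rewrite row_full_unit unitmx_inv.
  by split=> [|v]; rewrite ?/row_free E.
Qed.

Lemma frame_plucker N m (V : {vspace 'rV[k]_N}) (F : 'M[k]_(m, N)) :
  is_frame V F -> exists2 t : k, t != 0 &
    forall I : {ffun 'I_m -> 'I_N}, plucker I V = t * \det (colsub I F).
Proof.
move=> hF; have [fM mM] := basis_mx_frame (frame_dim hF).
have /submxP [T eT] : (basis_mx m V <= F)%MS.
  by apply/row_subP => i; rewrite -hF.2 mM row_sub.
exists (\det T) => [|I]; last by rewrite pluckerE eT -mulmx_colsub det_mulmx.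
rewrite -unitfE -unitmxE -row_free_unit.
by apply: (@row_free_left _ _ _ _ _ F); rewrite -eT.
Qed.

(** Together with the previous lemma, this describes maps into a Grassmannian:
    they are the families of subspaces with local regular frames. Two frames of
    the same subspace differ by an invertible matrix, so the ratios of their
    maximal minors agree. *)
Lemma morphism_to_Gr Z N m (U : {vspace 'rV[k]_N}) (c : Z -> Gr m U) :
  framed m (fun z => sval (c z)) -> morphism c.
Proof.
move=> fc; apply: morphism_generated => _ _ [I [J [-> ->]]].
have key z : plucker I (sval (c z)) != 0 -> exists W g,
    [/\ W z, regular (str Z) W g & forall y, W y -> plucker I (sval (c y)) != 0
      /\ g y = plucker J (sval (c y)) / plucker I (sval (c y))].
  move=> pz; have [O [F [Oz rF hF]]] := fc z.
  have rD (K : {ffun 'I_m -> 'I_N}) :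
      regular (str Z) O (fun y => \det (colsub K (F y))).
    apply: regular_det; apply: (mx_regular_sel (f := fun i _ => i)
      (g := fun _ j => K j) rF) => y i j; by rewrite mxE.
  have h y : O y -> (plucker I (sval (c y)) != 0) =
                    (\det (colsub I (F y)) != 0).
    move=> /hF /frame_plucker [t t0 e].
    by rewrite e mulf_eq0 (negPf t0).
  exists (O `&` [set y | \det (colsub I (F y)) != 0]),
    (fun y => \det (colsub J (F y)) * (\det (colsub I (F y)))^-1); split.
  - by split=> //; rewrite /mkset -h.
  - apply: regularM (regularV (rD I)).
    by apply: regular_sub (rD J) (zopen_neq0 (rD I)) _ => y [].
  - move=> y [Oy dy]; split; first by rewrite h.
    have [t t0 e] := frame_plucker (hF y Oy).
    by rewrite !e -mulf_div divff // mul1r.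
apply: regular_local => [|z /key [W [g [Wz rg h]]]].
  apply: zopen_local => z /key [W [g [Wz rg h]]].
  by exists W; split=> // [|y /h []//]; apply: regular_zopen rg.
by exists W, g; split=> // y [_ /h [_ ->]].
Qed.

End Families.

(** * Subspaces between two families are a locally trivial P^1-bundle *)

Section LineBundles.
Local Open Scope classical_set_scope.
Local Open Scope ring_scope.
Context {k : fieldType}.
Implicit Types X Y Z : fun_space k.

Lemma sval_inj (T : Type) (P : T -> Prop) (a b : {x : T | P x}) :
  sval a = sval b -> a = b.
Proof. by case: a b => [a pa] [b pb] /= e; apply: eq_exist. Qed.

Lemma frame_eqmx N m p (V : {vspace 'rV[k]_N}) (F : 'M[k]_(m, N))
    (G : 'M[k]_(p, N)) : is_frame V F -> is_frame V G -> (F :=: G)%MS.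
Proof.
move=> [_ hF] [_ hG]; apply/eqmxP/andP.
by split; apply/row_subP => i; [rewrite -hG hF|rewrite -hF hG]; apply: row_sub.
Qed.

(** The subspace of those u with u *m H in V. When H maps k^2 onto a complement
    of A in B, it is the line V / A in B / A. *)
Definition mx_preim N p (H : 'M[k]_(p, N)) (V : {vspace 'rV[k]_N}) :
    {vspace 'rV[k]_p} :=
  (linfun (mulmxr H : 'rV_p -> 'rV_N) @^-1: V)%VS.

Lemma mem_mx_preim N p (H : 'M[k]_(p, N)) (V : {vspace 'rV[k]_N}) u :
  (u \in mx_preim H V) = (u *m H \in V).
Proof. by rewrite -memv_preim lfunE. Qed.

(** The preimage is at most a line because V, of dimension m + 1, cannot contain
    the m + 2 independent rows of F and H; so any nonzero vector spans it. *)
Lemma mx_preim_frame N m (F : 'M[k]_(m, N)) (H : 'M[k]_(2, N))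
    (V : {vspace 'rV[k]_N}) (e : 'rV[k]_2) :
  row_free (col_mx F H) -> (forall v, (v <= F)%MS -> v \in V) ->
  \dim V = (m + 1)%N -> e != 0 -> e *m H \in V -> is_frame (mx_preim H V) e.
Proof.
move=> fG FV dV e0 eV; split=> [|v]; first by rewrite /row_free rank_rV e0.
have dL : (\dim (mx_preim H V) <= 1)%N.
  rewrite leqNgt; apply/negP => d2.
  have full : (mx_preim H V == fullv)%VS.
    by rewrite eqEdim subvf dimvf /dim /= mul1n.
  have HV u : u *m H \in V by rewrite -mem_mx_preim (eqP full) memvf.
  have [_ mM] := basis_mx_frame dV.
  have : (col_mx F H <= basis_mx (m + 1) V)%MS.
    rewrite col_mx_sub; apply/andP; split; apply/row_subP => i; rewrite -mM.
      by apply: FV; rewrite row_sub.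
    by rewrite rowE.
  move=> /mxrankS; rewrite (eqP fG) => /leq_trans /(_ (rank_leq_row _)).
  by rewrite leq_add2l.
have -> : mx_preim H V = <[e]>%VS.
  apply/esym/eqP; rewrite eqEdim dim_vline e0 dL andbT.
  by rewrite -memvE mem_mx_preim.
by apply/vlineP/sub_rVP.
Qed.

(** X is the space of pairs of a point y and a subspace of dimension m + 1
    between A y and B y, and V is the tautological family on it; [fb_univ] says
    that X carries the structure induced from Y and the Grassmannian. *)
Record flag_bundle X Y (f : X -> Y) N m (A B : Y -> {vspace 'rV[k]_N})
    (V : X -> {vspace 'rV[k]_N}) : Prop := FlagBundle {
  fb_morph : morphism f;
  fb_low : framed m A;
  fb_high : framed (m + 2) B;
  fb_sub : forall y, (A y <= B y)%VS;
  fb_mid : framed (m + 1) V;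
  fb_ge : forall x, (A (f x) <= V x)%VS;
  fb_le : forall x, (V x <= B (f x))%VS;
  fb_surj : forall y L, \dim L = (m + 1)%N -> (A y <= L)%VS -> (L <= B y)%VS ->
    exists x, f x = y /\ V x = L;
  fb_inj : forall x x', f x = f x' -> V x = V x' -> x = x';
  fb_univ : forall Z (c : Z -> X),
    morphism (f \o c) -> framed (m + 1) (V \o c) -> morphism c
}.

(** The two vectors added to the frame of A are combinations of a frame of B
    with constant coefficients, chosen to be independent of A at the given
    point; independence persists where the minor of columns J is invertible. *)
Lemma frame_pair Y N m (A B : Y -> {vspace 'rV[k]_N}) y :
  framed m A -> framed (m + 2) B -> (forall y, (A y <= B y)%VS) ->
  exists O (F : Y -> 'M[k]_(m, N)) (H : Y -> 'M[k]_(2, N))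
      (J : 'I_(m + 2) -> 'I_N),
    [/\ O y, mx_regular O F, mx_regular O H,
      forall z, O z -> is_frame (A z) (F z) /\ is_frame (B z) (col_mx (F z) (H z))
    & forall z, O z -> colsub J (col_mx (F z) (H z)) \in unitmx].
Proof.
move=> fA fB AB; have [U [F [Uy rF hF]]] := fA y.
have [U' [G [U'y rG hG]]] := fB y.
have FG z : U z -> U' z -> (F z <= G z)%MS.
  move=> /hF [_ mF] /hG [_ mG]; apply/row_subP => i; rewrite -mG.
  by apply: (subvP (AB z)); rewrite mF row_sub.
have [T eT] := submxP (FG y Uy U'y).
have fT : row_free T.
  by apply: (@row_free_left _ _ _ _ _ (G y)); rewrite -eT; case: (hF y Uy).
have [C fC] := row_free_complete fT (erefl (m + 2)%N).
pose H z := C *m G z.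
have fy : row_free (col_mx (F y) (H y)).
  rewrite /H eT -mul_col_mx /row_free mxrankMfree; first exact: fC.
  by case: (hG y U'y).
have [J uJ] := row_free_minor fy.
pose W := U `&` U'.
have oW : zopen (str Y) W by apply: zopenI; [apply: rF.1|apply: rG.1].
have rFW : mx_regular W F by apply: mx_regular_sub rF oW _ => z [].
have rHW : mx_regular W H.
  by apply: mx_regular_mull; apply: mx_regular_sub rG oW _ => z [].
have rJ : mx_regular W (fun z => colsub J (col_mx (F z) (H z))).
  apply: (mx_regular_sel (f := fun i _ => i) (g := fun _ => J)
    (mx_regular_col rFW rHW)) => z i j; by rewrite mxE.
pose O := W `&` [set z | colsub J (col_mx (F z) (H z)) \in unitmx].
have oO : zopen (str Y) O by apply: zopen_unit.
exists O, F, H, J; split=> //.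
- by apply: mx_regular_sub rFW oO _ => z [].
- by apply: mx_regular_sub rHW oO _ => z [].
- move=> z [[Uz U'z] uz]; split; first exact: hF.
  have fK := minor_row_free uz; split=> // v.
  have [fG mG] := hG z U'z; rewrite mG.
  have KG : (col_mx (F z) (H z) <= G z)%MS by rewrite col_mx_sub FG // submxMl.
  have GK : (G z <= col_mx (F z) (H z))%MS.
    by rewrite -(geq_leqif (mxrank_leqif_sup KG)) (eqP fG) (eqP fK).
  by apply/idP/idP => /submx_trans; apply.
- by move=> z [].
Qed.

(** Over a base on which A and B have adapted global frames, V corresponds to
    the line it cuts out in the trivial rank 2 bundle B / A. *)
Lemma flag_bundle_trivial X Y (f : X -> Y) N m (A B : Y -> {vspace 'rV[k]_N})
    (V : X -> {vspace 'rV[k]_N}) (F : Y -> 'M[k]_(m, N))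
    (H : Y -> 'M[k]_(2, N)) (J : 'I_(m + 2) -> 'I_N) :
  flag_bundle f m A B V ->
  mx_regular [set: Y] F -> mx_regular [set: Y] H ->
  (forall y, is_frame (A y) (F y)) ->
  (forall y, is_frame (B y) (col_mx (F y) (H y))) ->
  (forall y, colsub J (col_mx (F y) (H y)) \in unitmx) ->
  exists phi : X -> prod_space Y (P1 k),
    isomorphism phi /\ forall x, (phi x).1 = f x.
Proof.
move=> [mf _ _ AB fV geV leV surj inj univ] rF rH hA hB uJ.
pose G y := col_mx (F y) (H y).
have fG y : row_free (G y) by case: (hB y).
have FV x v : (v <= F (f x))%MS -> v \in V x.
  by rewrite -(hA _).2; apply/subvP.
have dV x : \dim (V x) = (m + 1)%N := framed_dim x fV.
pose L x := mx_preim (H (f x)) (V x).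
have rJ : mx_regular [set: X] (fun x => invmx (colsub J (G (f x)))).
  apply: mx_regular_inv => // [|x _]; last exact: uJ.
  apply: (mx_regular_comp (U := setT) (F := fun y => colsub J (G y)) mf).
  apply: (mx_regular_sel (f := fun i _ => i) (g := fun _ => J)
    (mx_regular_col rF rH)) => z i j; by rewrite mxE.
(* The H-coordinates of the vectors of a frame of V generate the line L; one of
   them is nonzero at the given point, hence nearby. *)
have fL : framed 1 L.
  move=> x; have [U [E [Ux rE hE]]] := fV x.
  pose Q z := colsub J (E z) *m invmx (colsub J (G (f z))).
  have EQ z : U z -> E z = Q z *m G (f z).
    move=> /hE [_ mE]; have /submxP [T eT] : (E z <= G (f z))%MS.
      apply/row_subP => i; rewrite -(hB _).2; apply: (subvP (leV z)).
      by rewrite mE row_sub.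
    by rewrite /Q eT -mulmx_colsub mulmxK // uJ.
  have HV z i : U z -> row i (rsubmx (Q z)) *m H (f z) \in V z.
    move=> Uz; have := EQ z Uz; rewrite -[Q z]hsubmxK mul_row_col row_mxKr.
    move=> /(congr1 (row i)); rewrite linearD /= !row_mul => /esym eE.
    have -> : row i (rsubmx (Q z)) *m H (f z) =
        row i (E z) - row i (lsubmx (Q z)) *m F (f z).
      by rewrite -eE addrC addKr.
    by rewrite rpredB //; [rewrite (hE z Uz).2 row_sub|apply: FV; rewrite submxMl].
  have [i [j ij]] : exists i j, rsubmx (Q x) i j != 0.
    apply: contrapT => h; have Q0 : rsubmx (Q x) = 0.
      apply/matrixP => i j; rewrite [RHS]mxE; apply/eqP.
      apply: contrapT => /negP hij.
      by apply: h; exists i, j.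
    have /(congr1 mxrank) := EQ x Ux.
    rewrite -[Q x]hsubmxK mul_row_col Q0 mul0mx addr0.
    rewrite (eqP (hE x Ux).1) => e.
    have := leq_trans (mxrankM_maxl (lsubmx (Q x)) (F (f x))) (rank_leq_col _).
    by rewrite -e addn1 ltnn.
  have rQ : mx_regular U Q.
    apply: mx_regular_mul; last exact: mx_regular_sub rJ rE.1 _.
    apply: (mx_regular_sel (f := fun i _ => i) (g := fun _ => J) rE).
    by move=> z a b; by rewrite mxE.
  have rK : mx_regular U (fun z => row i (rsubmx (Q z))).
    apply: (mx_regular_sel (f := fun _ _ => i) (g := fun _ b => rshift m b) rQ).
    by move=> z a b; rewrite !mxE.
  pose U' := U `&` [set z | row i (rsubmx (Q z)) 0 j != 0].
  have oU' : zopen (str X) U' := zopen_neq0 (rK.2 0 j).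
  exists U', (fun z => row i (rsubmx (Q z))); split.
  - by split=> //; rewrite /mkset mxE.
  - by apply: mx_regular_sub rK oU' _ => z [].
  - move=> z [Uz nz]; apply: mx_preim_frame (fG _) (FV z) (dV z) _ (HV z i Uz).
    by apply: contraNneq nz => ->; rewrite mxE.
have LP x : (L x <= fullv)%VS /\ \dim (L x) = 1%N.
  by split; [apply: subvf|apply: framed_dim fL].
pose phi x : prod_space Y (P1 k) := (f x, exist _ (L x) (LP x)).
pose S (z : prod_space Y (P1 k)) :=
  mx_vspace (col_mx (F z.1) (basis_mx 1 (sval z.2) *m H z.1)).
have frS (z : prod_space Y (P1 k)) (e : 'rV[k]_2) : is_frame (sval z.2) e ->
    is_frame (S z) (col_mx (F z.1) (e *m H z.1)).
  move=> he; have [fe _] := he.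
  have [_ dz] := svalP z.2; have hb := basis_mx_frame dz.
  split=> [|v].
    have fG1 : row_free (block_mx 1%:M 0 0 e : 'M_(m + 1, m + 2)).
      apply: inj_row_free => u; rewrite -[u]hsubmxK mul_row_block !mulmx0 addr0.
      rewrite add0r mulmx1 -[in X in _ = X]row_mx0 => /eq_row_mx [-> h].
      have -> : rsubmx u = 0 by apply: (row_free_inj fe); rewrite h mul0mx.
      by rewrite row_mx0.
    have -> : col_mx (F z.1) (e *m H z.1) =
        block_mx 1%:M 0 0 e *m col_mx (F z.1) (H z.1).
      by rewrite mul_block_col mul1mx !mul0mx addr0 add0r.
    by rewrite /row_free mxrankMfree; [exact: fG1|exact: fG].
  rewrite mem_mx_vspace -!addsmxE.
  have /eqmxMr := frame_eqmx hb he => /(_ _ (H z.1)) E.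
  by rewrite (adds_eqmx (eqmx_refl (F z.1)) E).
have dS z : \dim (S z) = (m + 1)%N.
  have [_ dz] := svalP z.2; exact: frame_dim (frS z _ (basis_mx_frame dz)).
have fS : framed (m + 1) S.
  move=> z.
  have fP := framed_comp (@morphism_snd k Y (P1 k)) (@framed_Gr k 2 1 fullv).
  have [U [e [Uz re he]]] := fP z.
  have sub (M : nat) (K : Y -> 'M[k]_(M, N)) : mx_regular [set: Y] K ->
      mx_regular U (fun z : prod_space Y (P1 k) => K z.1).
    move=> /(mx_regular_comp (@morphism_fst k Y (P1 k))) h.
    exact: mx_regular_sub h re.1 _.
  exists U, (fun z => col_mx (F z.1) (e z *m H z.1)); split=> //.
    apply: mx_regular_col; first exact: sub.
    by apply: mx_regular_mul => //; apply: sub.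
  by move=> z' /he; apply: frS.
have SA z : (A z.1 <= S z)%VS.
  apply/subvP => v; rewrite (hA _).2 mem_mx_vspace -addsmxE => h.
  exact: submx_trans h (addsmxSl _ _).
have SB z : (S z <= B z.1)%VS.
  apply/subvP => v; rewrite (hB _).2 mem_mx_vspace -!addsmxE => h.
  by apply: submx_trans h (addsmxS _ _) => //; apply: submxMl.
have psiP z : {x | f x = z.1 /\ V x = S z}.
  by apply: cid; apply: surj.
pose psi z := sval (psiP z).
have psi1 z : f (psi z) = z.1 by case: (svalP (psiP z)).
have psi2 z : V (psi z) = S z by case: (svalP (psiP z)).
exists phi; split=> //; split.
  by apply: morphism_to_prod => //; apply: morphism_to_Gr.
exists psi; split.
- apply: univ; last by apply: framed_ext fS _.
  by have -> : f \o psi = fst by [apply/funext => z; apply: psi1];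
    apply: morphism_fst.
- move=> x; apply: inj; rewrite ?psi1 ?psi2 //.
  apply/eqP; rewrite eqEdim dS dV leqnn andbT; apply/subvP => v.
  rewrite mem_mx_vspace -addsmxE => /sub_addsmxP [[a b] ->] /=.
  rewrite rpredD //; first by apply: FV; rewrite submxMl.
  rewrite mulmxA -mem_mx_preim.
  by rewrite (basis_mx_frame (LP x).2).2 submxMl.
- move=> z; apply: injective_projections; first exact: psi1.
  apply: sval_inj => /=; have [_ dz] := svalP z.2.
  have hb := basis_mx_frame dz; set e := basis_mx _ _ in hb.
  have he : is_frame (L (psi z)) e.
    apply: mx_preim_frame (fG _) (FV _) (dV _) _ _.
      by have := hb.1; rewrite /row_free rank_rV; case: (e != 0).
    by rewrite psi2 psi1 mem_mx_vspace -addsmxE addsmxSr.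
  by apply/vspaceP => v; rewrite he.2 hb.2.
Qed.

End LineBundles.

Section LineBundleFibration.
Local Open Scope classical_set_scope.
Local Open Scope ring_scope.
Context {k : fieldType}.
Implicit Types X Y Z : fun_space k.

Definition restrict X Y (f : X -> Y) (O : set Y) :
    sub_space (f @^-1` O) -> sub_space O :=
  fun x => exist _ (f (sval x)) (svalP x).

Lemma flag_bundle_restrict X Y (f : X -> Y) N m (A B : Y -> {vspace 'rV[k]_N})
    (V : X -> {vspace 'rV[k]_N}) (O : set Y) :
  flag_bundle f m A B V ->
  flag_bundle (@restrict _ _ f O) m (fun y => A (sval y)) (fun y => B (sval y))
    (fun x => V (sval x)).
Proof.
move=> [mf fA fB AB fV geV leV surj inj univ].
have mfs : morphism (fun x : sub_space (f @^-1` O) => f (sval x)).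
  exact: morphism_comp (morphism_sval _) mf.
split.
- exact: morphism_to_sub.
- exact: framed_comp (morphism_sval _) fA.
- exact: framed_comp (morphism_sval _) fB.
- by move=> y; apply: AB.
- exact: framed_comp (morphism_sval _) fV.
- by move=> x; apply: geV.
- by move=> x; apply: leV.
- move=> [y Oy] L dL AL LB; have [x [fx Vx]] := surj y L dL AL LB.
  have Ox : (f @^-1` O) x by rewrite /preimage /mkset fx.
  by exists (exist _ x Ox); split=> //; apply: sval_inj.
- move=> x x' /(congr1 sval) fx Vx; apply: sval_inj; exact: inj.
- move=> Z c mc fc; apply: morphism_to_sub; apply: univ; last exact: fc.
  exact: morphism_comp mc (morphism_sval _).
Qed.

Lemma flag_bundle_fibration X Y (f : X -> Y) N m (A B : Y -> {vspace 'rV[k]_N})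
    (V : X -> {vspace 'rV[k]_N}) :
  flag_bundle f m A B V -> P1_fibration f.
Proof.
move=> fb; split=> [|y]; first exact: fb_morph fb.
have [O [F [H [J [Oy rF rH hAB uJ]]]]] :=
  frame_pair y (fb_low fb) (fb_high fb) (fb_sub fb).
exists O; split=> //; first exact: rF.1.
have glob p q (K : Y -> 'M[k]_(p, q)) : mx_regular O K ->
    mx_regular [set: sub_space O] (fun z => K (sval z)).
  move=> /(mx_regular_comp (morphism_sval O)) rK.
  by apply: mx_regular_sub rK (zopenT _) _ => z _; apply: (svalP z).
have [|||||phi [iphi hphi]] := @flag_bundle_trivial _ _ _ _ _ _ _ _ _
  (fun z : sub_space O => F (sval z)) (fun z : sub_space O => H (sval z)) J
  (flag_bundle_restrict O fb).
- exact: glob.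
- exact: glob.
- by move=> z; case: (hAB _ (svalP z)).
- by move=> z; case: (hAB _ (svalP z)).
- by move=> z; apply: uJ (svalP z).
exists phi; split=> // x; by rewrite hphi.
Qed.

End LineBundleFibration.

(** * Coordinate subspaces and the symplectic form *)

Section Symplectic.
Local Open Scope ring_scope.
Context {k : fieldType}.

Lemma mem_coord_span N (D : pred 'I_N) (v : 'rV[k]_N) :
  v \in <<[seq (delta_mx 0 a)%R | a in D]>>%VS <-> forall a, ~~ D a -> v 0 a = 0.
Proof.
split=> [vD a Da|h].
  have /subvP /(_ v vD) : (<<[seq (delta_mx 0 b)%R | b in D]>> <=
      mx_preim (delta_mx a 0 : 'cV[k]_N)%R 0)%VS.
    apply/span_subvP => u /mapP [b]; rewrite mem_enum => Db ->.
    rewrite mem_mx_preim memv0.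
    by rewrite mul_delta_mx_0 //; apply: contraNneq Da => <-.
  rewrite mem_mx_preim memv0 -colE => /eqP /matrixP /(_ 0 0).
  by rewrite !mxE.
rewrite (row_sum_delta v); apply: rpred_sum => a _.
case Da: (D a); last by rewrite h ?Da // scale0r rpred0.
by apply: rpredZ; apply: memv_span; apply: map_f; rewrite mem_enum.
Qed.

Lemma dim_coord_span N (D : pred 'I_N) :
  \dim <<[seq (delta_mx 0 a : 'rV[k]_N)%R | a in D]>> = #|D|.
Proof.
pose F : 'M[k]_(#|D|, N) := rowsub (fun r : 'I_#|D| => enum_val r) 1%:M.
have rF r : row r F = delta_mx 0 (enum_val r) by rewrite row_rowsub row1.
apply: (@frame_dim _ _ _ _ F); split=> [|v].
  apply: (minor_row_free (I := fun r : 'I_#|D| => enum_val r)).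
  suff -> : colsub (fun r : 'I_#|D| => enum_val r) F = 1%:M by rewrite unitmx1.
  by apply/matrixP => r s; rewrite !mxE (inj_eq enum_val_inj).
apply/idP/idP => [|/submxP [u ->]].
  move=> /mem_coord_span h; rewrite (row_sum_delta v); apply: summx_sub => a _.
  case Da: (D a); last by rewrite h ?Da // scale0r sub0mx.
  apply: scalemx_sub; have aD : a \in D by [].
  by rewrite -(enum_rankK_in aD aD) -rF row_sub.
rewrite mulmx_sum_row; apply: rpred_sum => r _; apply: rpredZ.
by rewrite rF; apply: memv_span; apply: map_f; rewrite mem_enum enum_valP.
Qed.

Context {n : nat}.
Local Notation W := 'rV[k]_(2 * n).

Lemma mem_Wspan i j (v : W) :
  v \in Wspan k n i j <-> forall a : 'I_(2 * n), (i <= a < j)%N -> v 0 a = 0.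
Proof.
split=> [/mem_coord_span h a|h].
  by move=> ha; apply: h => /=; lia.
by apply/mem_coord_span => a /= ha; apply: h; lia.
Qed.

Lemma prE l (v : W) a : pr l v 0 a = if a.+1 == l then 0 else v 0 a.
Proof.
rewrite /pr summxE; case: eqP => [al|/eqP al].
  apply: big1 => b bl; rewrite !mxE eqxx /=; case: eqP => [ab|]; last by rewrite mulr0.
  by rewrite -ab al eqxx in bl.
rewrite (bigD1 a) //= !mxE !eqxx mulr1 big1 ?addr0 // => b /andP [_ ba].
by rewrite !mxE eqxx [a == b]eq_sym (negPf ba) mulr0.
Qed.

Lemma pr_decomp (c : 'I_(2 * n)) (v : W) : v = pr c.+1 v + v 0 c *: w k c.
Proof.
apply/rowP => a; rewrite mxE prE !mxE eqSS (inj_eq val_inj).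
by case: eqP => [->|]; rewrite ?mulr1 ?add0r // mulr0 addr0.
Qed.

Lemma sign_rev (a : 'I_(2 * n)) :
  (-1) ^+ (n <= rev_ord a)%N = - (-1) ^+ (n <= a)%N :> k.
Proof.
have -> : (n <= rev_ord a)%N = ~~ (n <= a)%N.
  by rewrite /= -ltnNge; have := ltn_ord a; lia.
by case: (n <= a)%N; rewrite ?expr1 ?expr0 ?opprK.
Qed.

Definition sympl_mx : 'M[k]_(2 * n) :=
  \matrix_(a, b) ((-1) ^+ (n <= a)%N * (b == rev_ord a)%:R).

Lemma symplE (u v : W) : u *m sympl_mx *m v^T = (sympl u v)%:M.
Proof.
rewrite [LHS]mx11_scalar; congr (_%:M); rewrite -mulmxA mxE.
apply: eq_bigr => a _; rewrite mxE (bigD1 (rev_ord a)) //= !mxE eqxx mulr1.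
rewrite big1 ?addr0; last by move=> b /negPf hb; rewrite !mxE hb mulr0 mul0r.
by rewrite mulrCA.
Qed.

Lemma sympl_mx_unit : sympl_mx \in unitmx.
Proof.
apply: (@mulmx1_unit _ _ _ sympl_mx^T _).1; apply/matrixP => a b.
rewrite mxE (bigD1 (rev_ord a)) //= !mxE eqxx mulr1 big1 ?addr0.
  rewrite (inj_eq rev_ord_inj); case: eqP => [->|]; last by rewrite !mulr0.
  by rewrite mulr1 -expr2 sqrr_sign.
by move=> c /negPf hc; rewrite !mxE hc mulr0 mul0r.
Qed.

Lemma symplDl (u u' v : W) : sympl (u + u') v = sympl u v + sympl u' v.
Proof.
by rewrite -big_split; apply: eq_bigr => a _; rewrite mxE mulrDl mulrDr.
Qed.

Lemma symplDr (u v v' : W) : sympl u (v + v') = sympl u v + sympl u v'.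
Proof.
by rewrite -big_split; apply: eq_bigr => a _; rewrite mxE mulrDr mulrDr.
Qed.

Lemma symplZl c (u v : W) : sympl (c *: u) v = c * sympl u v.
Proof.
by rewrite mulr_sumr; apply: eq_bigr => a _; rewrite mxE -mulrA mulrCA.
Qed.

Lemma symplZr c (u v : W) : sympl u (c *: v) = c * sympl u v.
Proof.
by rewrite mulr_sumr; apply: eq_bigr => a _; rewrite mxE !(mulrCA _ c).
Qed.

Lemma sympl_anti (u v : W) : sympl u v = - sympl v u.
Proof.
rewrite /sympl (reindex_inj rev_ord_inj) /= -sumrN; apply: eq_bigr => a _.
by rewrite rev_ordK sign_rev mulNr [u _ _ * _]mulrC.
Qed.

(** The terms of index a and 2n + 1 - a cancel; no division by 2
    is involved. *)
Lemma sympl_alt (v : W) : sympl v v = 0.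
Proof.
rewrite /sympl (bigID (fun a : 'I_(2 * n) => (n <= a)%N)) /=.
rewrite [X in _ + X](reindex_inj rev_ord_inj) /=.
rewrite [X in _ + X](eq_big (fun a : 'I_(2 * n) => (n <= a)%N)
  (fun a => - ((-1) ^+ (n <= a)%N * (v 0 a * v 0 (rev_ord a))))).
- by rewrite sumrN subrr.
- by move=> a /=; have := ltn_ord a; lia.
- by move=> a _; rewrite sign_rev rev_ordK mulNr [v _ _ * _]mulrC.
Qed.

Lemma sympl_w (a : 'I_(2 * n)) (v : W) :
  sympl (w k a) v = (-1) ^+ (n <= a)%N * v 0 (rev_ord a).
Proof.
rewrite /sympl (bigD1 a) //= !mxE !eqxx mul1r big1 ?addr0 // => b /negPf ba.
by rewrite !mxE ba andbF mul0r mulr0.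
Qed.

Definition perp (U : {vspace W}) : {vspace W} :=
  mx_preim ((basis_mx (\dim U) U *m sympl_mx)^T) 0.

Lemma mem_perp (U : {vspace W}) v :
  v \in perp U <-> forall u, u \in U -> sympl u v = 0.
Proof.
have [_ mM] := basis_mx_frame (erefl (\dim U)).
have s0 u : u *m sympl_mx *m v^T = 0 <-> sympl u v = 0.
  rewrite symplE; split=> [/matrixP /(_ 0 0)|->]; last by rewrite raddf0.
  by rewrite !mxE.
rewrite mem_mx_preim memv0; split=> [/eqP h u|h].
  rewrite mM => /submxP [c ->]; apply/s0.
  have : basis_mx (\dim U) U *m sympl_mx *m v^T = 0.
    by rewrite -[LHS]trmxK trmx_mul trmxK h trmx0.
  by rewrite -!mulmxA => ->; rewrite mulmx0.
apply/eqP/trmx_inj; rewrite trmx_mul trmxK trmx0; apply/row_matrixP => i.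
by rewrite row_mul row0 row_mul; apply/s0/h; rewrite mM row_sub.
Qed.

Lemma framed_symp_perp (X : fun_space k) m p (A : X -> {vspace W}) :
  framed m A -> (m + p)%N = (2 * n)%N -> framed p (fun x => perp (A x)).
Proof.
move=> fA e; apply: (framed_perp sympl_mx_unit fA e) => x v.
rewrite mem_perp; split=> h a /h; rewrite symplE; first by move=> ->; rewrite raddf0.
by move=> /matrixP /(_ 0 0); rewrite !mxE.
Qed.

(** Isotropy of L only has to be tested against the hyperplane A of L: the form
    is alternating, so a further vector is orthogonal to itself. *)
Lemma isotropic_hyperplane (A L : {vspace W}) :
  (A <= L)%VS -> \dim L = (\dim A).+1 -> (L <= perp A)%VS -> isotropic L.
Proof.
move=> AL dL /subvP Lp.
have [x xL xA] : exists2 x, x \in L & x \notin A.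
  by apply/subvPn; apply/negP => /dimvS; rewrite dL ltnn.
have perpA a v : a \in A -> v \in L -> sympl a v = 0.
  by move=> aA /Lp /mem_perp; apply.
have eL : L = (A + <[x]>)%VS.
  apply/esym/eqP; rewrite eqEdim subv_add AL -memvE xL /= dL.
  have Ax0 : (A :&: <[x]> = 0)%VS.
    apply/eqP; rewrite -subv0; apply/subvP => v; rewrite memv_cap memv0.
    case/andP=> vA /vlineP [c ec]; apply/eqP; move: vA; rewrite ec.
    have [->|c0] := eqVneq c 0; first by rewrite scale0r.
    move=> /(rpredZ (c^-1)) ; rewrite scalerA mulVf // scale1r.
    by rewrite (negPf xA).
  have xn0 : x != 0 by apply: contraNneq xA => ->; rewrite mem0v.
  by rewrite dimv_disjoint_sum // dim_vline xn0 addn1.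
move=> u v; rewrite {1}eL => /memv_addP [a aA [_ /vlineP [s ->] ->]] vL.
rewrite symplDl symplZl perpA // add0r; move: vL.
rewrite eL => /memv_addP [b bA [_ /vlineP [t ->] ->]].
by rewrite symplDr symplZr sympl_alt mulr0 addr0 sympl_anti perpA // oppr0 mulr0.
Qed.

End Symplectic.

(** * Adding the subspaces one at a time *)

Lemma card_ord_interval N i j : (j <= N)%N ->
  #|[pred a : 'I_N | (i <= a < j)%N]| = (j - i)%N.
Proof.
move=> jN; rewrite -[RHS]muln1 -sum_nat_const_nat -sum1_card.
rewrite (big_nat_widen _ _ _ _ _ jN) (big_nat_widenl _ 0) // big_mkord.
by apply: eq_bigl => a; rewrite /= andbC.
Qed.

Section Tower.
Local Open Scope classical_set_scope.
Local Open Scope ring_scope.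
Context {k : fieldType} {n : nat} {d : seq nat}.
Local Notation W := 'rV[k]_(2 * n).
Local Notation Pd := (Pd n d).
Local Notation ambient := (SpR_ambient k n d).
Implicit Types (p q : Pd) (V : ambient) (S : {set Pd}).

Lemma PdP p : [/\ (0 < row_of p)%N, (row_of p <= col_of p)%N,
  (row_of p + col_of p <= 2 * n)%N &
  has (fun dl => (row_of p <= dl <= col_of p)%N) d].
Proof. by case/and4P: (svalP p). Qed.

Lemma Pd_eq p q : row_of p = row_of q -> col_of p = col_of q -> p = q.
Proof.
move=> r c; apply: val_inj; apply: injective_projections; exact: val_inj.
Qed.

Lemma Pd_exists i j : (0 < i)%N -> (i <= j)%N -> (i + j <= 2 * n)%N ->
  has (fun dl => (i <= dl <= j)%N) d -> exists p, row_of p = i /\ col_of p = j.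
Proof.
move=> i0 ij ijn h.
have hi : (i < 2 * n)%N by lia.
have hj : (j < 2 * n)%N by lia.
have P : inP d (Ordinal hi, Ordinal hj) by apply/and4P.
by exists (exist _ (Ordinal hi, Ordinal hj) P).
Qed.

Lemma Pd_left p : (1 < row_of p)%N ->
  exists q, row_of p = (row_of q).+1 /\ col_of q = col_of p.
Proof.
move=> r1; have [_ rc rn /hasP [x xd hx]] := PdP p.
have [||||q [rq cq]] := @Pd_exists (row_of p).-1 (col_of p); try lia.
  by apply/hasP; exists x => //; lia.
by exists q; rewrite rq cq prednK //; lia.
Qed.

Lemma Pd_up p : (row_of p + col_of p < 2 * n)%N ->
  exists q, row_of q = row_of p /\ col_of q = (col_of p).+1.
Proof.
move=> r1; have [r0 rc rn /hasP [x xd hx]] := PdP p.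
have [||||q [rq cq]] := @Pd_exists (row_of p) (col_of p).+1; try lia.
  by apply/hasP; exists x => //; lia.
by exists q.
Qed.

Definition prec p q : Prop :=
  (row_of q = (row_of p).+1 /\ col_of q = col_of p) \/
  (row_of p = row_of q /\ col_of p = (col_of q).+1).

Definition closed_index S : Prop :=
  forall p q, q \in S -> prec p q -> p \in S.

(** The conditions defining SpR, imposed only on the subspaces indexed by S. The
    others are held equal to those of a base point V0, so that the spaces of
    partial collections all lie in the same product. *)
Definition SpR_on (V0 : ambient) S : set ambient := [set V |
  [/\ forall p q, p \in S -> q \in S ->
        row_of q = (row_of p).+1 -> col_of q = col_of p ->
        (sval (V p) <= sval (V q))%VS,
      forall p q, p \in S -> q \in S ->
        row_of q = row_of p -> col_of q = (col_of p).+1 ->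
        forall v, v \in sval (V p) -> pr (col_of p).+1 v \in sval (V q),
      forall p, p \in S -> (row_of p + col_of p)%N = (2 * n)%N ->
        isotropic (sval (V p))
    & forall p, p \notin S -> V p = V0 p]].

Lemma comp_Wspan V p : (sval (V p) <= Wspan k n (row_of p) (col_of p))%VS.
Proof. by case: (svalP (V p)). Qed.

Lemma Wspan_sub i i' j j' : (i <= i')%N -> (j' <= j)%N ->
  (Wspan k n i j <= Wspan k n i' j')%VS.
Proof.
move=> ii jj; apply/subvP => v /mem_Wspan h; apply/mem_Wspan => a ha.
by apply: h; lia.
Qed.

Lemma framed_component p : framed (row_of p) (fun V : ambient => sval (V p)).
Proof.
exact: framed_comp (morphism_proj _ p) (@framed_Gr _ _ _ _).
Qed.

(** The lower bound V_{i-1,j} for V_{i,j}, with the convention V_{0,j} = 0. *)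
Definition low p V : {vspace W} :=
  if [pick q | (row_of p == (row_of q).+1) && (col_of q == col_of p)] is Some q
  then sval (V q) else 0%VS.

Lemma lowP p : (exists q, [/\ row_of p = (row_of q).+1, col_of q = col_of p
    & forall V, low p V = sval (V q)]) \/
  (row_of p = 1%N /\ forall V, low p V = 0%VS).
Proof.
rewrite /low; case: pickP => [q /andP [/eqP rq /eqP cq]|h].
  by left; exists q.
right; split=> //; have [r0 _ _ _] := PdP p.
apply/eqP; rewrite eqn_leq r0 andbT leqNgt; apply/negP => /Pd_left [q [rq cq]].
by have := h q; rewrite rq cq !eqxx.
Qed.

Lemma low_eq p q V : row_of p = (row_of q).+1 -> col_of q = col_of p ->
  low p V = sval (V q).
Proof.
move=> rq cq; case: (lowP p) => [[q' [rq' cq' ->]]|[r1 _]].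
  by have -> : q = q' by apply: Pd_eq; [apply: succn_inj; rewrite -rq|rewrite cq].
by have [q0 _ _ _] := PdP q; move: r1; rewrite rq => -[]; lia.
Qed.

Lemma framed_low p : framed (row_of p).-1 (low p).
Proof.
case: (lowP p) => [[q [rq _ h]]|[r1 h]]; apply: framed_ext h.
  by rewrite rq; apply: framed_component.
by apply: framed_cst; rewrite r1 dimv0.
Qed.

Lemma low_Wspan p V : (low p V <= Wspan k n (row_of p).-1 (col_of p))%VS.
Proof.
case: (lowP p) => [[q [rq cq ->]]|[r1 ->]]; last exact: sub0v.
by rewrite rq -cq; apply: comp_Wspan.
Qed.

(** The constraints that the other components put on the subspace of index p,
    apart from containing the component to its left. *)
Definition allowed p V (L : {vspace W}) : Prop :=
  [/\ (L <= Wspan k n (row_of p) (col_of p))%VS,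
      forall q, row_of q = row_of p -> col_of q = (col_of p).+1 ->
        forall v, v \in L -> pr (col_of p).+1 v \in sval (V q)
    & (row_of p + col_of p)%N = (2 * n)%N -> isotropic L].

(** On the diagonal i + j = 2n, the orthogonal of this subspace is the
    orthogonal of V_{i-1,j} within W_{i,j}. *)
Definition low_plus p V : {vspace W} :=
  (low p V + <<[seq w k a | a in
     [pred a : 'I_(2 * n) | (row_of p <= a < col_of p)%N]]>>)%VS.

Definition high p V : {vspace W} :=
  if [pick q | (row_of q == row_of p) && (col_of q == (col_of p).+1)] is Some q
  then (sval (V q) + <[w k (sval p).2]>)%VS else perp (low_plus p V).

Lemma highP p :
  (exists q, [/\ row_of q = row_of p, col_of q = (col_of p).+1
    & forall V, high p V = (sval (V q) + <[w k (sval p).2]>)%VS]) \/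
  ((row_of p + col_of p)%N = (2 * n)%N /\
    forall V, high p V = perp (low_plus p V)).
Proof.
rewrite /high; case: pickP => [q /andP [/eqP rq /eqP cq]|h].
  by left; exists q.
right; split=> //; have [_ _ rn _] := PdP p.
apply/eqP; rewrite eqn_leq rn leqNgt; apply/negP => /Pd_up [q [rq cq]].
by have := h q; rewrite rq cq !eqxx.
Qed.

Lemma framed_high p : framed (row_of p).+1 (high p).
Proof.
have [r0 rc rn _] := PdP p.
case: (highP p) => [[q [rq cq h]]|[rcn h]]; apply: framed_ext h.
  rewrite -[(row_of p).+1]addn1; apply: framed_add.
    by rewrite -rq; apply: framed_component.
    apply: framed_cst; rewrite dim_vline; case: eqP => // /matrixP /(_ 0 (sval p).2).
    by rewrite !mxE !eqxx => /eqP; rewrite oner_eq0.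
  move=> V; apply/eqP; rewrite -subv0; apply/subvP => v; rewrite memv_cap memv0.
  case/andP=> vq /vlineP [c e]; have /mem_Wspan := subvP (comp_Wspan V q) _ vq.
  move=> /(_ (sval p).2); rewrite rq cq ltnSn andbT => /(_ rc).
  by rewrite e !mxE !eqxx mulr1 => ->; rewrite scale0r.
apply: (@framed_symp_perp _ _ _ ((row_of p).-1 + (col_of p - row_of p))).
  apply: framed_add; first exact: framed_low.
    apply: framed_cst; rewrite dim_coord_span card_ord_interval //.
    exact: ltnW (ltn_ord (sval p).2).
  move=> V; apply/eqP; rewrite -subv0; apply/subvP => v; rewrite memv_cap memv0.
  case/andP=> /(subvP (low_Wspan p V)) /mem_Wspan h1 /mem_coord_span h2.
  apply/eqP/rowP => a; rewrite [RHS]mxE.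
  case ha : (row_of p <= a < col_of p)%N; last by apply: h2; rewrite /= ha.
  by apply: h1; lia.
lia.
Qed.

Lemma mem_interval_perp p (v : W) : (row_of p + col_of p)%N = (2 * n)%N ->
  (forall a : 'I_(2 * n), (row_of p <= a < col_of p)%N -> sympl (w k a) v = 0) <->
  v \in Wspan k n (row_of p) (col_of p).
Proof.
move=> rc; rewrite mem_Wspan; split=> h a ha; last first.
  by rewrite sympl_w h ?mulr0 //=; have := ltn_ord a; lia.
have := h (rev_ord a); rewrite sympl_w rev_ordK => /(_ _)/eqP.
rewrite mulf_eq0 signr_eq0 /= => /(_ _)/eqP; apply.
by have := ltn_ord a; lia.
Qed.

Lemma allowed_high p V L :
  (low p V <= L)%VS -> allowed p V L -> (L <= high p V)%VS.
Proof.
move=> lowL [LW Lpr Liso].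
case: (highP p) => [[q [rq cq ->]]|[rc ->]]; apply/subvP => v vL.
  rewrite (pr_decomp (sval p).2 v); apply: memv_add.
    exact: Lpr.
  exact: memvZ (memv_line _).
apply/mem_perp => _ /memv_addP [a /(subvP lowL) aL [b bK ->]].
rewrite symplDl Liso // add0r.
have h := (mem_interval_perp v rc).2 (subvP LW _ vL).
have /subvP /(_ b bK) /mem_perp /(_ v (memv_line v)) vb :
    (<<[seq w k a | a in [pred a : 'I_(2 * n) |
      (row_of p <= a < col_of p)%N]]>> <= perp <[v]>)%VS.
  apply/span_subvP => u /mapP [c]; rewrite mem_enum => /h hc ->.
  by apply/mem_perp => u' /vlineP [t ->]; rewrite symplZl sympl_anti hc oppr0 mulr0.
by rewrite sympl_anti vb oppr0.
Qed.

Lemma high_allowed p V L : \dim L = row_of p -> (low p V <= L)%VS ->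
  (L <= high p V)%VS -> allowed p V L.
Proof.
move=> dL lowL; have [r0 rc rn _] := PdP p.
case: (highP p) => [[q [rq cq ->]]|[rcn ->]] Lhigh.
  split.
  - apply: subv_trans Lhigh _; rewrite subv_add; apply/andP; split.
      by apply: subv_trans (comp_Wspan V q) _; apply: Wspan_sub; rewrite ?rq ?cq.
    rewrite -memvE; apply/mem_Wspan => a ha; rewrite !mxE eqxx /=.
    by case: eqP => // e; move: ha; rewrite e /col_of ltnn andbF.
  - move=> q' rq' cq' v vL; have -> : q' = q by apply: Pd_eq; lia.
    have /memv_addP [u uq [_ /vlineP [t ->] ->]] := subvP Lhigh _ vL.
    suff -> : pr (col_of p).+1 (u + t *: w k (sval p).2) = u by [].
    apply/rowP => a; rewrite prE eqSS !mxE; case: eqP => [e|ne].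
      have /mem_Wspan := subvP (comp_Wspan V q) _ uq; move=> /(_ a) -> //.
      by rewrite e rq cq; lia.
    by case: (a =P (sval p).2) => [e|]; [case: ne; rewrite e|rewrite mulr0 addr0].
  - by move=> e; have [_ _ qn _] := PdP q; exfalso; lia.
have Lperp a : a \in low_plus p V -> forall v, v \in L -> sympl a v = 0.
  by move=> ha v /(subvP Lhigh) /mem_perp; apply.
split.
- apply/subvP => v vL; apply/(mem_interval_perp v rcn) => a ha.
  apply: Lperp => //; apply: (subvP (addvSr _ _)).
  by apply: memv_span; apply: map_f; rewrite mem_enum.
- by move=> q rq cq; have [_ _ qn _] := PdP q; exfalso; lia.
- move=> _; apply: (isotropic_hyperplane lowL).
    by rewrite (framed_dim V (framed_low p)) prednK.
  apply/subvP => v vL; apply/mem_perp => a ha; apply: Lperp => //.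
  exact: (subvP (addvSl _ _)).
Qed.

(** Deleting a coordinate does not change the form on vectors whose dual
    coordinate vanishes. *)
Lemma sympl_pr (c : 'I_(2 * n)) (u v : W) :
  u 0 (rev_ord c) = 0 -> v 0 (rev_ord c) = 0 ->
  sympl (pr c.+1 u) (pr c.+1 v) = sympl u v.
Proof.
move=> u0 v0.
have h (x : W) : x 0 (rev_ord c) = 0 -> sympl (w k c) (pr c.+1 x) = 0.
  by move=> x0; rewrite sympl_w prE x0 if_same mulr0.
rewrite [in RHS](pr_decomp c u) [in RHS](pr_decomp c v).
rewrite symplDl !symplDr !symplZl !symplZr h // sympl_alt.
by rewrite [sympl _ (w k c)]sympl_anti h // oppr0 !mulr0 !addr0.
Qed.

Lemma prec_left p q : row_of p = (row_of q).+1 -> col_of q = col_of p -> prec q p.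
Proof. by move=> r c; left. Qed.

Lemma prec_up p q : row_of q = row_of p -> col_of q = (col_of p).+1 -> prec q p.
Proof. by move=> r c; right. Qed.

Lemma prec_neq p q : prec p q -> p != q.
Proof. by move=> h; apply/eqP => e; move: h; rewrite e => -[] [] ? ?; lia. Qed.

(** The constraints hold for V_{i-1,j} because they hold for V_{i-1,j+1}, into
    which it is projected: that space lies in V_{i,j+1}, and it is isotropic
    when i + j = 2n. *)
Lemma allowed_low V0 S p V : closed_index S -> closed_index (S :\ p) ->
  p \in S -> SpR_on V0 (S :\ p) V -> allowed p V (low p V).
Proof.
move=> cS cSp pS [Vincl Vpr Viso _]; have [r0 rc rn _] := PdP p.
have inS q : prec q p -> q \in S :\ p.
  by move=> qp; rewrite !inE (prec_neq qp) (cS _ _ pS).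
(* V_{i-1,j+1} is where pr_{j+1} sends V_{i-1,j}. *)
have corner r : row_of p = (row_of r).+1 -> col_of r = col_of p ->
    exists s, [/\ s \in S :\ p, row_of s = row_of r, col_of s = (col_of p).+1
      & forall v, v \in sval (V r) -> pr (col_of p).+1 v \in sval (V s)].
  move=> rr cr; have [|s [rs cs]] := @Pd_up r; first by lia.
  have rS : r \in S :\ p by apply: inS; apply: prec_left.
  have sS : s \in S :\ p by apply: cSp rS _; apply: prec_up.
  exists s; split=> //; first by rewrite cs cr.
  by move=> v vr; rewrite -cr; apply: Vpr vr.
split.
- by apply: subv_trans (low_Wspan p V) _; apply: Wspan_sub; lia.
- move=> q rq cq v; case: (lowP p) => [[r [rr cr ->]]|[_ ->]].
    have [s [sS rs cs h]] := corner r rr cr; move=> /h; apply/subvP.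
    apply: Vincl => //; first by apply: inS; apply: prec_up.
      by rewrite rq rr rs.
    by rewrite cq cs.
  rewrite memv0 => /eqP ->; suff -> : pr (col_of p).+1 0 = 0 :> W by apply: mem0v.
  by apply/rowP => a; rewrite prE mxE if_same.
- move=> rcn; case: (lowP p) => [[r [rr cr ->]]|[_ ->]]; last first.
    move=> u v; rewrite memv0 => /eqP -> _.
    by rewrite -(scale0r (0 : W)) symplZl mul0r.
  have [s [sS rs cs h]] := corner r rr cr.
  have dual0 v : v \in sval (V r) -> v 0 (rev_ord (sval p).2) = 0.
    move=> /(subvP (comp_Wspan V r)) /mem_Wspan; apply => /=.
    by have := ltn_ord (sval p).2; rewrite /col_of in cr rc rcn *; lia.
  move=> u v ur vr; rewrite -(sympl_pr (c := (sval p).2)) ?dual0 //.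
  apply: (Viso s) => //; [by lia|exact: h|exact: h].
Qed.

Definition update V p (L : Gr (row_of p) (Wspan k n (row_of p) (col_of p))) :
    ambient :=
  @eqtype.dfwith _ (fun q => Gr (row_of q) (Wspan k n (row_of q) (col_of q))) V p L.

Lemma update_in V p L : @update V p L p = L.
Proof. by rewrite /update dfwith_in. Qed.

Lemma update_out V p L q : q != p -> @update V p L q = V q.
Proof. by move=> qp; rewrite /update dfwith_out // eq_sym. Qed.

(** Removing from S an index p that does not precede any other leaves a
    fibration: V_p is any subspace of dimension i between V_{i-1,j} and the
    space of dimension i + 1 determined by V_{i,j+1}, or by the form. *)
Lemma SpR_on_fibration V0 S p :
  closed_index S -> closed_index (S :\ p) -> p \in S ->
  exists f : sub_space (SpR_on V0 S) -> sub_space (SpR_on V0 (S :\ p)),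
    P1_fibration f.
Proof.
move=> cS cSp pS; have [r0 rc rn _] := PdP p.
have Sp q : q \in S -> q != p -> q \in S :\ p by move=> qS qp; rewrite !inE qp.
have pred_in q : prec q p -> q \in S.
  by move=> qp; apply: cS pS qp.
have no_succ q : q \in S -> prec p q -> False.
  move=> qS pq; have : p \in S :\ p.
    apply: (cSp p q) => //; apply: Sp => //; rewrite eq_sym; exact: prec_neq.
  by rewrite !inE eqxx.
have fP (x : sub_space (SpR_on V0 S)) :
    SpR_on V0 (S :\ p) (update (sval x) (V0 p)).
  case: x => V [Vincl Vpr Viso Vout] /=; split.
  - move=> q q' /setD1P [qp qS] /setD1P [q'p q'S]; rewrite !update_out //; exact: Vincl.
  - move=> q q' /setD1P [qp qS] /setD1P [q'p q'S]; rewrite !update_out //; exact: Vpr.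
  - move=> q /setD1P [qp qS]; rewrite update_out //; exact: Viso.
  - move=> q; have [->|qp] := eqVneq q p; first by rewrite update_in.
    by rewrite !inE qp /= update_out //; apply: Vout.
pose f (x : sub_space (SpR_on V0 S)) : sub_space (SpR_on V0 (S :\ p)) :=
  exist _ (update (sval x) (V0 p)) (fP x).
have fE x q : q != p -> sval (f x) q = sval x q by move=> qp; apply: update_out.
(* The bounds on V_p only involve indices other than p. *)
have lowE V V' : (forall q, q != p -> V q = V' q) -> low p V = low p V'.
  move=> e; case: (lowP p) => [[q [rq cq h]]|[_ h]]; rewrite !h // e //.
  by apply: prec_neq; apply: prec_left.
have highE V V' : (forall q, q != p -> V q = V' q) -> high p V = high p V'.
  move=> e; case: (highP p) => [[q [rq cq h]]|[_ h]]; rewrite !h.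
    by rewrite e //; apply: prec_neq; apply: prec_up.
  by rewrite /low_plus (lowE _ _ e).
exists f.
have e1 : ((row_of p).-1 + 1)%N = row_of p by lia.
have e2 : ((row_of p).-1 + 2)%N = (row_of p).+1 by lia.
have allowed_x (x : sub_space (SpR_on V0 S)) : allowed p (sval x) (sval (sval x p)).
  case: x => V [Vincl Vpr Viso Vout] /=; split.
  - exact: comp_Wspan.
  - by move=> q rq cq; apply: Vpr => //; apply: pred_in; apply: prec_up.
  - exact: Viso.
have low_x (x : sub_space (SpR_on V0 S)) : (low p (sval x) <= sval (sval x p))%VS.
  case: x => V [Vincl Vpr Viso Vout] /=.
  case: (lowP p) => [[q [rq cq ->]]|[_ ->]]; last exact: sub0v.
  by apply: Vincl => //; apply: pred_in; apply: prec_left.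
apply: (@flag_bundle_fibration _ _ _ f (2 * n) (row_of p).-1
  (fun y => low p (sval y)) (fun y => high p (sval y))
  (fun x => sval (sval x p))).
split.
- apply: morphism_to_sub; apply: morphism_to_bigprod => q.
  have [->|qp] := eqVneq q p.
    have -> : (fun z => sval (f z) p) = fun=> V0 p.
      by apply/funext => z; apply: update_in.
    exact: morphism_cst.
  have -> : (fun z => sval (f z) q) = fun z => sval z q.
    by apply/funext => z; apply: fE.
  exact: morphism_comp (morphism_sval _) (morphism_proj _ q).
- exact: framed_comp (morphism_sval _) (framed_low p).
- rewrite e2; exact: framed_comp (morphism_sval _) (framed_high p).
- move=> y; apply: allowed_high (subvv _) _; exact: allowed_low cS cSp pS (svalP y).
- rewrite e1; exact: framed_comp (morphism_sval _) (framed_component p).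
- by move=> x; rewrite (lowE _ (sval x)) //; apply: fE.
- move=> x; rewrite (highE _ (sval x)); last exact: fE.
  exact: allowed_high.
- move=> y L dL lowL Lhigh; rewrite e1 in dL.
  have aL := high_allowed dL lowL Lhigh.
  have [LW Lpr Liso] := aL.
  pose G : Gr (row_of p) (Wspan k n (row_of p) (col_of p)) :=
    exist _ L (conj LW dL).
  have [Vincl Vpr Viso Vout] := svalP y.
  have xP : SpR_on V0 S (update (sval y) G).
    split.
    + move=> q q' qS q'S rq cq; have qq' : prec q q' by left.
      have [e|qp] := eqVneq q p; first by case: (no_succ q' q'S); rewrite -e.
      rewrite (update_out _ _ qp); have [e|q'p] := eqVneq q' p.
        by subst q'; rewrite update_in /= -(low_eq _ rq).
      by rewrite update_out //; apply: Vincl => //; apply: Sp.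
    + move=> q q' qS q'S rq cq; have qq' : prec q' q by right.
      have [e|q'p] := eqVneq q' p; first by case: (no_succ q qS); rewrite -e.
      rewrite (update_out _ _ q'p); have [e|qp] := eqVneq q p.
        by subst q; rewrite update_in /=; apply: Lpr.
      by rewrite update_out //; apply: Vpr => //; apply: Sp.
    + move=> q qS; have [e|qp] := eqVneq q p; first by subst q; rewrite update_in.
      by rewrite update_out //; apply: Viso; apply: Sp.
    + move=> q qS; have qp : q != p by apply: contraNneq qS => ->.
      by rewrite update_out //; apply: Vout; rewrite !inE negb_and qS orbT.
  exists (exist _ _ xP); split; last by rewrite /= update_in.
  apply: sval_inj; apply: functional_extensionality_dep => q.
  have [->|qp] := eqVneq q p; last by rewrite fE //= update_out.
  by rewrite /= update_in Vout // !inE eqxx.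
- move=> x x' ff pp; apply: sval_inj; apply: functional_extensionality_dep => q.
  have [->|qp] := eqVneq q p; first exact: sval_inj.
  by rewrite -(fE x) // -(fE x') // ff.
- move=> Z c mc fc; apply: morphism_to_sub; apply: morphism_to_bigprod => q.
  have [->|qp] := eqVneq q p; first by rewrite e1 in fc; apply: morphism_to_Gr.
  have -> : (fun z => sval (c z) q) = fun z => sval (f (c z)) q.
    by apply/funext => z; rewrite fE.
  exact: morphism_comp mc (morphism_comp (morphism_sval _) (morphism_proj _ q)).
Qed.

Lemma base_point : ambient.
Proof.
move=> p; have [r0 rc rn _] := PdP p.
exists <<[seq w k a | a in [pred a : 'I_(2 * n) | (0 <= a < row_of p)%N]]>>%VS.
split; last by rewrite dim_coord_span card_ord_interval ?subn0 //; lia.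
apply/subvP => v /mem_coord_span h; apply/mem_Wspan => a ha.
by apply: h => /=; lia.
Qed.

Lemma SpR_on_empty V0 : isomorphic (sub_space (SpR_on V0 finset.set0)) (@point_space k).
Proof.
have P0 : SpR_on V0 finset.set0 V0.
  by split=> // p; rewrite ?inE // => q; rewrite inE.
exists (fun=> tt : @point_space k); split; first exact: morphism_cst.
exists (fun=> exist _ V0 P0); split; first exact: morphism_cst.
- move=> [V [? ? ? Vout]]; apply: sval_inj => /=.
  by apply: functional_extensionality_dep => p; rewrite Vout ?inE.
- by case.
Qed.

(** Induction on S, removing each time an index p = (i, j) with i - j maximal:
    indices precede others with a larger difference. *)
Lemma SpR_on_tower V0 S : closed_index S -> P1_tower (sub_space (SpR_on V0 S)).
Proof.
have [m] := ubnP #|S|; elim: m S => // m IH S Sm cS.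
have [->|[p0 p0S]] := set_0Vmem S; first by apply: P1_tower_point; apply: SpR_on_empty.
pose wt p := (row_of p + (2 * n - col_of p))%N.
have [p pS pmax] : exists2 p, p \in S & forall q, q \in S -> (wt q <= wt p)%N.
  by case: (arg_maxnP wt p0S) => p; exists p.
have cSp : closed_index (S :\ p).
  move=> q q' /setD1P [q'p q'S] qq'; rewrite !inE (cS _ _ q'S qq') andbT.
  apply: contraTneq (pmax _ q'S) => qp; rewrite qp in qq'.
  have lt (r : Pd) : (col_of r < 2 * n)%N := ltn_ord (sval r).2.
  by have := lt p; have := lt q'; rewrite /wt -ltnNge; case: qq' => -[-> ->]; lia.
have [f hf] := SpR_on_fibration V0 cS cSp pS.
apply: P1_tower_step hf _; apply: IH => //.
by move: Sm; rewrite (cardsD1 p) pS.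
Qed.

Lemma SpR_on_full V0 : SpR_on V0 [set: Pd]%SET = @SpR_set k n d.
Proof.
apply/seteqP; split=> V.
  case=> Vincl Vpr Viso _.
  by split=> [p q|p q|p]; [apply: Vincl|apply: Vpr|apply: Viso]; rewrite inE.
case=> Vincl Vpr Viso; split=> [p q _ _|p q _ _|p _|p]; last by rewrite inE.
- exact: Vincl.
- exact: Vpr.
- exact: Viso.
Qed.

Lemma SpR_tower : P1_tower (SpR k n d).
Proof.
rewrite /SpR -(SpR_on_full base_point); apply: SpR_on_tower => p q _ _.
by rewrite inE.
Qed.

End Tower.

Local Open Scope ring_scope.

Theorem proposition5p10 (R : realType) (n : nat) (d : seq nat)
  (d_size : (0 < size d)%N)
  (d_incr : sorted ltn d)
  (d_range : all (fun dl => (1 <= dl <= n)%N) d) :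
  P1_tower (SpR R[i] n d).
Proof. exact: SpR_tower. Qed.
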